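(* Let $R$ be a commutative Noetherian local ring and let $N$ be a nonzero finitely generated Tor-rigid $R$-module. Then: (i) $\operatorname{depth}(N)\le\dim(M)+\operatorname{grade}(M)$ for all nonzero finitely generated $R$-modules $M$. (ii) $\operatorname{depth}(N)\le\operatorname{depth}(R)$. (iii) If $N$ is maximal Cohen-Macaulay, then $R$ is Cohen-Macaulay.
   Context: A finitely generated $R$-module $N$ is Tor-rigid if for every finitely generated $R$-module $L$: if $\operatorname{Tor}^R_n(N,L)=0$ for some $n\ge1$, then $\operatorname{Tor}^R_{n+1}(N,L)=0$. For a nonzero finitely generated $R$-module $M$, $\operatorname{grade}(M)=\inf\{i\ge0:\operatorname{Ext}^i_R(M,R)\ne0\}$. A nonzero finitely generated module $N$ is maximal Cohen-Macaulay if $\operatorname{depth}(N)=\dim(R)$. *)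

(* Defs.v *)
From HB Require Import structures.
From mathcomp Require Import all_boot all_order all_algebra.
From mathcomp Require Import boolp classical_sets constructive_ereal.

Set Implicit Arguments.
Unset Strict Implicit.
Unset Printing Implicit Defensive.

Import Order.TTheory GRing.Theory Num.Theory.
Local Open Scope classical_set_scope.
Local Open Scope ring_scope.

Definition noetherian (R : comNzRingType) : Prop :=
  forall I : {pred R^o}, GRing.submod_closed I ->
    exists (n : nat) (a : 'I_n -> R),
      forall x : R, x \in I <-> exists c : 'I_n -> R, x = \sum_i c i * a i.

(* An element of [idealr R] is a proper ideal. *)
Definition maximal_ideal (R : comNzRingType) (m : idealr R) : Prop :=
  forall J : idealr R, {subset m <= J} -> {subset J <= m}.

Definition local_ring (R : comNzRingType) (m : idealr R) : Prop :=
  maximal_ideal m /\ forall m' : idealr R, maximal_ideal m' -> m' =i m.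

Definition finitely_generated (R : comNzRingType) (M : lmodType R) : Prop :=
  exists (n : nat) (g : 'I_n -> M),
    forall x : M, exists c : 'I_n -> R, x = \sum_i c i *: g i.

Definition nonzero_module (R : comNzRingType) (M : lmodType R) : Prop :=
  exists x : M, x <> 0.

(* Suprema and infima are taken in [\bar int], where every set of natural
   numbers has both; sup set0 = -oo and inf set0 = +oo. *)
Definition esup (A : set nat) : \bar int :=
  supremum -oo%E [set n%:Z%:E%E | n in A].

Definition einf (A : set nat) : \bar int :=
  infimum +oo%E [set n%:Z%:E%E | n in A].

(* P 0 < P 1 < ... < P n; the values of P beyond n are irrelevant. *)
Definition prime_chain (R : comNzRingType) (n : nat)
    (P : nat -> prime_idealr R) : Prop :=
  forall i, (i < n)%N ->
    {subset P i <= P i.+1} /\ ~ {subset P i.+1 <= P i}.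

Definition ring_dim (R : comNzRingType) : \bar int :=
  esup [set n | exists P : nat -> prime_idealr R, prime_chain n P].

(* The Krull dimension of R / Ann(M), in terms of primes containing Ann(M). *)
Definition module_dim (R : comNzRingType) (M : lmodType R) : \bar int :=
  esup [set n | exists2 P : nat -> prime_idealr R, prime_chain n P &
    forall a : R, (forall x : M, a *: x = 0) -> a \in P 0%N].

(* y belongs to the submodule (s_0, ..., s_(k-1)) N. *)
Definition in_ideal_mul (R : comNzRingType) (N : lmodType R) (s : seq R)
    (y : N) : Prop :=
  exists z : 'I_(size s) -> N, y = \sum_(i < size s) s`_i *: z i.

(* s_i is a nonzerodivisor on N / (s_0, ..., s_(i-1)) N for every i, and
   N <> (s) N. *)
Definition regular_seq (R : comNzRingType) (N : lmodType R) (s : seq R) : Prop :=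
  (forall i, (i < size s)%N -> forall y : N,
     in_ideal_mul (take i s) (s`_i *: y) -> in_ideal_mul (take i s) y) /\
  (exists y : N, ~ in_ideal_mul s y).

Definition depth (R : comNzRingType) (m : idealr R) (N : lmodType R) :
    \bar int :=
  esup [set n | exists s : seq R,
    [/\ size s = n, {subset s <= m} & regular_seq N s]].

(* ... -> R^(b 2) -> R^(b 1) -> R^(b 0) -> L -> 0 exact, with row vectors, so
   that the differentials act by right multiplication. *)
Record free_resolution (R : comNzRingType) (L : lmodType R) := FreeResolution {
  rk : nat -> nat;
  diff : forall i, 'M[R]_(rk i.+1, rk i);
  aug : {linear 'rV[R]_(rk 0) -> L};
  aug_surj : forall x : L, exists u, aug u = x;
  aug_exact : forall u, aug u = 0 <-> exists w, u = w *m diff 0;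
  diff_exact : forall i (u : 'rV[R]_(rk i.+1)),
    u *m diff i = 0 <-> exists w, u = w *m diff i.+1
}.

(* N (x) R^b is {ffun 'I_b -> N}, with x (x) u = (u_j x)_j. *)
Definition tens (R : comNzRingType) (N : lmodType R) (b : nat)
    (x : N) (u : 'rV[R]_b) : {ffun 'I_b -> N} :=
  [ffun j => u 0 j *: x].

(* id_N (x) A, for A : R^b -> R^c. *)
Definition tens_mx (R : comNzRingType) (N : lmodType R) (b c : nat)
    (A : 'M[R]_(b, c)) (v : {ffun 'I_b -> N}) : {ffun 'I_c -> N} :=
  [ffun j => \sum_i A i j *: v i].

Lemma tens_mxE (R : comNzRingType) (N : lmodType R) (b c : nat)
    (A : 'M[R]_(b, c)) (x : N) (u : 'rV[R]_b) :
  tens_mx A (tens x u) = tens x (u *m A).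
Proof.
apply/ffunP => j; rewrite !ffunE !mxE scaler_suml.
by apply: eq_bigr => i _; rewrite ffunE scalerA mulrC.
Qed.

Lemma tens_universal (R : comNzRingType) (N W : lmodType R) (b : nat)
    (f : {bilinear N -> 'rV[R]_b -> W}) :
  exists g : {linear {ffun 'I_b -> N} -> W},
    (forall x u, g (tens x u) = f x u) /\
    (forall g' : {linear {ffun 'I_b -> N} -> W},
       (forall x u, g' (tens x u) = f x u) -> g' =1 g).
Proof.
pose h (v : {ffun 'I_b -> N}) : W := \sum_i f (v i) (delta_mx 0 i).
have h_lin : linear h.
  move=> a v w; rewrite /h scaler_sumr -big_split; apply: eq_bigr => i _ /=.
  by rewrite !ffunE linearPl.
pose g := HB.pack h (GRing.isLinear.Build _ _ _ _ h h_lin)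
  : {linear {ffun 'I_b -> N} -> W}.
exists g; split=> [x u | g' g'E v].
  rewrite [in RHS](row_sum_delta u) linear_sumr; apply: eq_bigr => i _ /=.
  by rewrite ffunE linearZl_LR linearZr.
have -> : v = \sum_i tens (v i) (delta_mx 0 i).
  apply/ffunP => j; rewrite sum_ffunE (bigD1 j) //= big1 => [|i ij].
    by rewrite ffunE mxE !eqxx scale1r addr0.
  by rewrite ffunE mxE eqxx eq_sym (negPf ij) scale0r.
rewrite !linear_sum; apply: eq_bigr => i _; rewrite g'E.
rewrite /= /h (bigD1 i) //= big1 => [|j ji].
  by rewrite ffunE mxE !eqxx scale1r addr0.
by rewrite ffunE mxE eqxx (negPf ji) scale0r linear0l.
Qed.

Definition Tor_homology_zero (R : comNzRingType) (N L : lmodType R)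
    (F : free_resolution L) (n : nat) : Prop :=
  match n with
  | 0 => forall v : {ffun 'I_(rk F 0) -> N}, exists w, v = tens_mx (diff F 0) w
  | k.+1 => forall v : {ffun 'I_(rk F k.+1) -> N},
      tens_mx (diff F k) v = 0 -> exists w, v = tens_mx (diff F k.+1) w
  end.

(* Tor_n(N, L) = 0.  Resolutions by finite free modules exist as soon as R is
   noetherian and L is finitely generated. *)
Definition Tor_zero (R : comNzRingType) (n : nat) (N L : lmodType R) : Prop :=
  exists F : free_resolution L, Tor_homology_zero N F n.

Definition Ext_cohomology_zero (R : comNzRingType) (M N : lmodType R)
    (F : free_resolution M) (n : nat) : Prop :=
  match n with
  | 0 => forall f : {linear 'rV[R]_(rk F 0) -> N},
      (forall u, f (u *m diff F 0) = 0) -> forall u, f u = 0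
  | k.+1 => forall f : {linear 'rV[R]_(rk F k.+1) -> N},
      (forall u, f (u *m diff F k.+1) = 0) ->
      exists g : {linear 'rV[R]_(rk F k) -> N}, forall u, f u = g (u *m diff F k)
  end.

(* Ext^n(M, N) = 0, with the same proviso on M as for Tor. *)
Definition Ext_zero (R : comNzRingType) (n : nat) (M N : lmodType R) : Prop :=
  exists F : free_resolution M, Ext_cohomology_zero N F n.

Definition Tor_rigid (R : comNzRingType) (N : lmodType R) : Prop :=
  forall L : lmodType R, finitely_generated L ->
    forall n, (1 <= n)%N -> Tor_zero n N L -> Tor_zero n.+1 N L.

Definition grade (R : comNzRingType) (M : lmodType R) : \bar int :=
  einf [set i | ~ Ext_zero i M R^o].

Definition maximal_Cohen_Macaulay (R : comNzRingType) (m : idealr R)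
    (N : lmodType R) : Prop :=
  [/\ nonzero_module N, finitely_generated N & depth m N = ring_dim R].

Definition Cohen_Macaulay_ring (R : comNzRingType) (m : idealr R) : Prop :=
  depth m (R^o : lmodType R) = ring_dim R.

(* Main.v *)
(* A sequence x regular on a Tor-rigid module N is regular on R.  Indeed
   Tor_1(N, R/(x)) vanishes because N-valued relations between the x_i come from
   Koszul relations; rigidity gives Tor_2(N, R/(x)) = 0, so that N kills the
   module of syzygies of x modulo the Koszul ones, which is therefore zero by
   Nakayama.  This is (ii).

   If I = Ann(M) and d = dim(M), a regular sequence of length n in the maximal
   ideal can be exchanged for a regular sequence of length n - d in I: as long as
   I consists of zerodivisors on a quotient R/J of depth k, it lies in an
   associated prime of R/J, and such a prime starts a chain of k + 1 primes.  A
   regular sequence of length t in Ann(M) makes Ext^i(M, R) vanish for i < t,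
   hence (i).  The same chains show depth(R) <= dim(R), hence (iii). *)
Require Import Defs.
From HB Require Import structures.
From mathcomp Require Import all_boot all_order all_algebra.
From mathcomp Require Import boolp classical_sets constructive_ereal.
From mathcomp Require Import ring.

Set Implicit Arguments.
Unset Strict Implicit.
Unset Printing Implicit Defensive.

Import Order.TTheory GRing.Theory Num.Theory.
Local Open Scope classical_set_scope.
Local Open Scope ring_scope.

(** In (i), the count n - d survives only if dividing by a regular y in Ann(M) costs at most one
    unit of depth, whichever y was found. [depth_ge_adj] proves this by elements, carrying a class
    killed by the maximal ideal from R/(J + yR) to R/(J + xR); both socles are the usual Hom and
    Ext^1 of the residue field.

    The obstacle in (ii) is that regularity on N yields Koszul relations with coefficients in N,
    while a statement over R is wanted. Since N is nonzero and finitely generated, it has a nonzero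
    map to the residue field; applied to an equality in N (x) F_2, this map gives a congruence
    modulo m between coefficients in R, which is what Nakayama takes as input.

    Vanishing of Tor is asserted on some resolution, so what rigidity returns must be moved to the
    resolution of R/(x) that begins with x. *)

Definition submodule (R : comNzRingType) (V : lmodType R) (W : set V) : Prop :=
  W 0 /\ forall a u v, W u -> W v -> W (a *: u + v).

Section Submodules.
Variables (R : comNzRingType) (V : lmodType R) (W : set V).
Hypothesis W_sub : submodule W.

Lemma submodule0 : W 0. Proof. by case: W_sub. Qed.

Lemma submoduleD u v : W u -> W v -> W (u + v).
Proof. by move=> Wu Wv; rewrite -[u]scale1r; apply: W_sub.2. Qed.

Lemma submoduleZ a u : W u -> W (a *: u).
Proof. by move=> Wu; rewrite -[_ *: _]addr0; apply: W_sub.2 => //; apply: submodule0. Qed.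

Lemma submoduleN u : W u -> W (- u).
Proof. by rewrite -scaleN1r; apply: submoduleZ. Qed.

Lemma submoduleB u v : W u -> W v -> W (u - v).
Proof. by move=> Wu Wv; apply/submoduleD/submoduleN. Qed.

Lemma submodule_sum I (r : seq I) (P : pred I) (F : I -> V) :
  (forall i, P i -> W (F i)) -> W (\sum_(i <- r | P i) F i).
Proof.
by move=> WF; apply: big_ind WF; [apply: submodule0 | apply: submoduleD].
Qed.

End Submodules.

(** * Ideals J standing for the quotients R/J *)

Section Ideals.
Variable R : comNzRingType.
Implicit Types (I J P Q : set R) (a b x y z : R).

Definition ideal I : Prop := @submodule R R^o I.

Lemma ideal0 I : ideal I -> I 0. Proof. exact: submodule0. Qed.

Lemma idealD I x y : ideal I -> I x -> I y -> I (x + y).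
Proof. by move=> I_id; apply: (@submoduleD R R^o). Qed.

Lemma idealB I x y : ideal I -> I x -> I y -> I (x - y).
Proof. by move=> I_id; apply: (@submoduleB R R^o). Qed.

Lemma idealN I x : ideal I -> I x -> I (- x).
Proof. by move=> I_id; apply: (@submoduleN R R^o). Qed.

Lemma idealM I a x : ideal I -> I x -> I (a * x).
Proof. by move=> I_id; apply: (@submoduleZ R R^o). Qed.

Lemma idealMl I a x : ideal I -> I a -> I (a * x).
Proof. by move=> I_id; rewrite mulrC; apply: idealM. Qed.

Lemma ideal_sum I (T : Type) (r : seq T) (p : pred T) (F : T -> R) :
  ideal I -> (forall i, p i -> I (F i)) -> I (\sum_(i <- r | p i) F i).
Proof. by move=> I_id; apply: (@submodule_sum R R^o). Qed.

Lemma ideal_set0 : ideal [set 0].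
Proof. by split=> // a u v -> ->; rewrite scaler0 addr0. Qed.

Definition colon J a : set R := [set r | J (r * a)].

Lemma colon_ideal J a : ideal J -> ideal (colon J a).
Proof.
move=> J_id; split=> [|r u v Ju Jv]; rewrite /colon /= ?mul0r; first exact: ideal0.
by rewrite mulrDl -mulrA; apply: idealD => //; apply: idealM.
Qed.

Definition adj J x : set R := [set r | exists j b, J j /\ r = j + b * x].

Lemma adj_ideal J x : ideal J -> ideal (adj J x).
Proof.
move=> J_id; split=> [|a _ _ [j [b [Jj ->]]] [k [c [Jk ->]]]].
  by exists 0, 0; rewrite mul0r addr0; split=> //; apply: ideal0.
exists (a * j + k), (a * b + c); split; last by rewrite /GRing.scale /=; ring.
by apply: idealD => //; apply: idealM.
Qed.

Lemma sub_adj J x : J `<=` adj J x.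
Proof. by move=> j Jj; exists j, 0; rewrite mul0r addr0. Qed.

Lemma adj_mul J x b : ideal J -> adj J x (b * x).
Proof. by move=> J_id; exists 0, b; rewrite add0r; split=> //; apply: ideal0. Qed.

Lemma adj_gen J x : ideal J -> adj J x x.
Proof. by move=> J_id; rewrite -[X in adj _ _ X]mul1r; apply: adj_mul. Qed.

Lemma adj_swap J x y : adj (adj J x) y = adj (adj J y) x.
Proof.
suff sub u v : adj (adj J u) v `<=` adj (adj J v) u by apply/seteqP.
move=> _ [_ [b [[j [c [Jj ->]]] ->]]]; exists (j + b * v), c.
by split; [exists j, b | ring].
Qed.

(* x is a nonzerodivisor on R/J. *)
Definition nzd J x : Prop := forall a, J (x * a) -> J a.

Fixpoint regular_mod J (s : seq R) : Prop :=
  if s is x :: s' then nzd J x /\ regular_mod (adj J x) s' else True.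

Definition prime_ideal P : Prop :=
  [/\ ideal P, ~ P 1 & forall u v, P (u * v) -> P u \/ P v].

Definition associated J P : Prop :=
  prime_ideal P /\ exists a, ~ J a /\ P = colon J a.

Lemma idealr_ideal (I : idealr R) : ideal [set x | x \in I].
Proof.
split=> [|a u v Iu Iv] /=; first exact: idealr0.
by apply: rpredD => //; apply: idealMr.
Qed.

Lemma ideal_closed I : ideal I -> ~ I 1 -> idealr_closed (fun x : R => `[< I x >]).
Proof.
move=> I_id I1; split=> [||a u v]; rewrite !unfold_in.
- by apply/asboolP; apply: ideal0.
- exact/asboolPn.
- by move=> /asboolP Iu /asboolP Iv; apply/asboolP; apply: idealD => //; apply: idealM.
Qed.

Definition pack_idealr I (I_id : ideal I) (I1 : ~ I 1) : idealr R :=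
  HB.pack (fun x : R => `[< I x >]) (isIdealr.Build _ _ (ideal_closed I_id I1)).

Lemma prime_closed P : prime_ideal P -> prime_idealr_closed (fun x : R => `[< P x >]).
Proof.
move=> [_ _ PM] u v; rewrite !unfold_in => /asboolP/PM[?|?]; apply/orP.
  by left; apply/asboolP.
by right; apply/asboolP.
Qed.

Definition pack_prime P (P_pr : prime_ideal P) : prime_idealr R :=
  HB.pack (fun x : R => `[< P x >])
    (isIdealr.Build _ _ (let: And3 P_id P1 _ := P_pr in ideal_closed P_id P1))
    (isPrimeIdealrClosed.Build _ _ (prime_closed P_pr)).

Lemma pack_idealrE I (I_id : ideal I) (I1 : ~ I 1) x :
  x \in pack_idealr I_id I1 <-> I x.
Proof. by rewrite unfold_in; split=> /asboolP. Qed.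

Lemma pack_primeE P (P_pr : prime_ideal P) x : x \in pack_prime P_pr <-> P x.
Proof. by rewrite unfold_in; split=> /asboolP. Qed.

End Ideals.

(** * Associated primes and prime avoidance *)

Section Noetherian.
Variable R : comNzRingType.
Hypothesis R_noeth : noetherian R.
Implicit Types (I J P Q : set R) (a b x y z : R).

Lemma ideal_fg I : ideal I -> exists n (a : 'I_n -> R),
  forall x, I x <-> exists c : 'I_n -> R, x = \sum_i c i * a i.
Proof.
move=> I_id; have [|n [a aP]] := R_noeth (I := fun x : R^o => `[< I x >]).
  split=> [|c u v]; rewrite !unfold_in; first by apply/asboolP; apply: ideal0.
  by move=> /asboolP Iu /asboolP Iv; apply/asboolP/I_id.2.
by exists n, a => x; rewrite -aP unfold_in; split=> /asboolP.
Qed.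

Lemma ideal_acc (F : nat -> set R) :
  (forall n, ideal (F n)) -> (forall n, F n `<=` F n.+1) ->
  exists n, F n.+1 = F n.
Proof.
move=> F_id F_incr.
have F_mono k n : F n `<=` F (k + n)%N.
  by elim: k => [|k IHk] //=; apply: subset_trans IHk _; apply: F_incr.
have F_le k n : (k <= n)%N -> F k `<=` F n by move=> /subnK <-; apply: F_mono.
have [|p [a aP]] := ideal_fg (I := \bigcup_n F n).
  split=> [|c u v [i _ Fu] [j _ Fv]]; first by exists 0%N => //; exact: (ideal0 (F_id _)).
  exists (maxn i j) => //; apply: (F_id _).2.
    by apply: F_le Fu; rewrite leq_maxl.
  by apply: F_le Fv; rewrite leq_maxr.
have : forall i, exists n, F n (a i).
  move=> i; suff [n _ Fn] : (\bigcup_n F n) (a i) by exists n.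
  apply/aP; exists (fun j => (j == i)%:R).
  rewrite (bigD1 i) //= eqxx mul1r big1 ?addr0 // => j /negPf->.
  by rewrite mul0r.
case/choice => f fP; exists (\max_i f i); apply/seteqP; split=> [x Fx|]; last exact: F_incr.
have [c ->] : exists c : 'I_p -> R, x = \sum_i c i * a i by apply/aP; exists (\max_i f i).+1.
apply: ideal_sum => // i _; apply: idealM => //.
by apply: F_le (fP i); apply: leq_bigmax.
Qed.

Lemma ideal_maximal (F : set (set R)) :
  (forall I, F I -> ideal I) -> F !=set0 ->
  exists I, F I /\ forall J, F J -> I `<=` J -> J = I.
Proof.
move=> F_id [I0 FI0]; apply: contrapT => no_max.
have : forall I : {I | F I}, exists J : {I | F I},
    sval I `<=` sval J /\ sval J <> sval I.
  case=> I FI; apply: contrapT => noJ; apply: no_max; exists I; split=> // J FJ IJ.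
  by apply: contrapT => neq; apply: noJ; exists (exist _ J FJ).
case/choice=> f fP; pose c n := iter n f (exist _ I0 FI0).
have [||n /esym cn] := @ideal_acc (fun n => sval (c n)).
- by move=> n; apply/F_id/svalP.
- by move=> n; case: (fP (c n)).
- by case: (fP (c n)) => _; case.
Qed.

(** A maximal member (J : a) among the proper colon ideals above (J : b) is prime: if uv kills the
    class of a and v does not, then (J : va) contains (J : a), so the two agree, and u lies in the
    former. *)
Lemma associated_above J b : ideal J -> ~ J b ->
  exists2 P, associated J P & colon J b `<=` P.
Proof.
move=> J_id Jb.
have [|| P [[a [Ja [-> sub_a]]] a_max]] :=
  @ideal_maximal [set I | exists a, ~ J a /\ (I = colon J a /\ colon J b `<=` colon J a)].
- by move=> _ [a [_ [-> _]]]; apply: colon_ideal.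
- by exists (colon J b); exists b; split=> //; split=> //; exact: subset_refl.
exists (colon J a) => //; split; last by exists a.
split; [exact: colon_ideal | by rewrite /colon /= mul1r | move=> u v Juv].
have [Jv|Jv] := EM (J (v * a)); [by right | left].
have /a_max <- : [set I | exists a, ~ J a /\ (I = colon J a /\ colon J b `<=` colon J a)]
    (colon J (v * a)).
- exists (v * a); split=> //; split=> // r /sub_a Jra.
  by rewrite /colon /= mulrCA; apply: idealM.
- by rewrite /colon /= mulrA.
- by move=> r Jra; rewrite /colon /= mulrCA; apply: idealM.
Qed.

(** Noetherian induction: given one associated prime P = (J : a), every other associated prime of J
    is associated to the larger ideal J + aR. *)
Lemma associated_finite J0 : ideal J0 ->
  exists L : seq (set R), forall P, associated J0 P -> P \in L.
Proof.
move=> J0_id; apply: contrapT => infJ.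
pose bad : set (set R) := [set J | ideal J /\
  ~ exists L : seq (set R), forall P, associated J P -> P \in L].
have [||J [[J_id J_inf] J_max]] := @ideal_maximal bad.
- by move=> I [].
- by exists J0.
have [J1|J1] := EM (J 1).
  apply: J_inf; exists [::] => P [_ [a [[]]]].
  by rewrite -[a]mulr1; apply: idealM.
have [P [P_pr [a [Ja Pa]]] _] := associated_above J_id J1.
have [L LP] : exists L : seq (set R), forall Q, associated (adj J a) Q -> Q \in L.
  apply: contrapT => bad_adj; apply: Ja.
  by rewrite -(J_max (adj J a)); [exact: adj_gen | split=> //; apply: adj_ideal | exact: sub_adj].
apply: J_inf; exists (P :: L) => Q [Q_pr [c [Jc Qc]]].
have Q_id : ideal Q by case: Q_pr.
rewrite in_cons; apply/orP.
(* If rc lies in J + aR with r outside Q, its class modulo J is a multiple sa; its annihilator is Q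
   when read from c and P when read from a. Otherwise Q is also the annihilator of c modulo J +
   aR. *)
have [[r [Qr [j [s [Jj rcE]]]]]|no_r] := EM (exists r, ~ Q r /\ adj J a (r * c)); [left|right].
  apply/eqP.
  have Ps : ~ P s.
    rewrite Pa /colon /= => Jsa; apply: Qr; rewrite Qc /colon /= rcE.
    exact: idealD.
  apply/seteqP; split=> t.
    move=> Qt; have : Q (t * r) by apply: idealMl.
    rewrite Qc /colon /= -mulrA rcE mulrDr => /(idealB J_id) /(_ (idealM t J_id Jj)).
    rewrite addrAC subrr add0r mulrA => Jtsa.
    have : P (t * s) by rewrite Pa.
    by case: P_pr => _ _ /[apply] -[].
  move=> Pt; have : Q (t * r).
    rewrite Qc /colon /= -mulrA rcE mulrDr; apply: idealD => //; first exact: idealM.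
    by move: Pt; rewrite Pa /colon /= mulrCA; apply: idealM.
  by case: Q_pr => _ _ /[apply] -[].
apply: LP; split=> //; exists c; split.
  move=> Jac; apply: no_r; exists 1; rewrite mul1r; split=> //; by case: Q_pr.
apply/seteqP; split=> r.
  by rewrite {1}Qc => Jr; apply: sub_adj.
move=> Jr; apply: contrapT => Qr; apply: no_r; exists r; split=> //.
Qed.

Lemma prime_avoidance I (L : seq (set R)) : ideal I ->
  (forall P, P \in L -> prime_ideal P /\ exists2 x, I x & ~ P x) ->
  exists2 x, I x & forall P, P \in L -> ~ P x.
Proof.
move=> I_id; elim: L => [|P L IHL] LP; first by exists 0 => //; apply: ideal0.
have [|x Ix x_avoid] := IHL; first by move=> Q QL; apply: LP; rewrite in_cons QL orbT.
have [[P_id P1 PM] [a Ia Pa]] := LP P (mem_head _ _).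
have [Px|Px] := EM (P x); last first.
  by exists x => // Q; rewrite in_cons => /orP[/eqP->|/x_avoid].
(* Here [x] avoids [L] but lies in [P]. Adding a [y] outside [P] that lies in each member of [L] not
   contained in [P] changes nothing for those members; the members inside [P] are avoided because
   [x + y] is not in [P]. *)
have [y [Iy Py] y_in] : exists2 y, I y /\ ~ P y & forall Q, Q \in L -> ~ (Q `<=` P) -> Q y.
  have : forall Q, Q \in L -> ideal Q.
    by move=> Q QL; have [|[]] := LP Q; rewrite ?in_cons ?QL ?orbT.
  elim: {IHL LP x_avoid} L => [|Q L IHL] L_id; first by exists a.
  have [|y [Iy Py] y_in] := IHL; first by move=> Q' Q'L; apply: L_id; rewrite in_cons Q'L orbT.
  have [QP|/existsNP[b /not_implyP[Qb Pb]]] := EM (Q `<=` P).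
    exists y => // Q'; rewrite in_cons => /orP[/eqP->|/y_in] //.
  exists (b * y).
    split; [exact: idealM | by move=> /PM []].
  move=> Q'; rewrite in_cons => /orP[/eqP-> _|Q'L nQ'].
    by apply: idealMl => //; apply: L_id; rewrite mem_head.
  by apply: idealM; [apply: L_id; rewrite in_cons Q'L orbT | apply: y_in].
have Pxy : ~ P (x + y) by move=> /(idealB P_id) /(_ Px); rewrite addrAC subrr add0r.
exists (x + y); first exact: idealD.
move=> Q; rewrite in_cons => /orP[/eqP->//|QL].
have [QP|nQP] := EM (Q `<=` P); first by move=> /QP.
have [|[Q_id _ _] _] := LP Q; first by rewrite in_cons QL orbT.
move=> /(idealB Q_id) /(_ (y_in _ QL nQP)); rewrite addrK; exact: x_avoid.
Qed.

Lemma not_nzd J x : ~ nzd J x -> exists2 a, J (x * a) & ~ J a.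
Proof. by move=> /existsNP[a /not_implyP[]]; exists a. Qed.

(** Prime avoidance for the associated primes of J1 and J2 together; [depth_ge_adj] needs one
    element regular on two quotients at once. *)
Lemma common_nzd I J1 J2 : ideal I -> ideal J1 -> ideal J2 ->
  (exists z, [/\ I z, nzd J1 z & nzd J2 z]) \/
  ((exists2 b, ~ J1 b & I `<=` colon J1 b) \/ (exists2 b, ~ J2 b & I `<=` colon J2 b)).
Proof.
move=> I_id J1_id J2_id.
have [[J [b [JE [Jb IJ]]]]|no_b] :=
  EM (exists J b, (J = J1 \/ J = J2) /\ (~ J b /\ I `<=` colon J b)).
  by right; case: JE Jb IJ => -> Jb IJ; [left|right]; exists b.
left; have [L1 L1P] := associated_finite J1_id; have [L2 L2P] := associated_finite J2_id.
pose L := [seq P : set R <- L1 ++ L2 | `[< associated J1 P \/ associated J2 P >]].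
have memL P : (associated J1 P \/ associated J2 P) <-> P \in L.
  rewrite mem_filter mem_cat; split=> [PA|/andP[/asboolP]//].
  by apply/andP; split; [exact/asboolP | case: PA => [/L1P|/L2P] ->; rewrite ?orbT].
have [|z Iz z_avoid] := @prime_avoidance I L I_id.
  move=> P /memL PA; have P_pr : prime_ideal P by case: PA => -[].
  split=> //; apply: contrapT => IP; apply: no_b.
  have {}IP : I `<=` P by move=> x Ix; apply: contrapT => Px; apply: IP; exists x.
  by case: PA => -[_ [b [Jb PE]]]; [exists J1, b | exists J2, b]; rewrite -PE; split; auto.
suff nzdz J : ideal J -> (J = J1 \/ J = J2) -> nzd J z by exists z; split=> //; apply: nzdz; auto.
move=> J_id JE; apply: contrapT => /not_nzd[a Jza Ja].
have [P PA subP] := associated_above J_id Ja.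
by apply: (z_avoid P); [apply/memL; case: JE PA => ->; auto | apply: subP].
Qed.

End Noetherian.

(** * Nakayama's lemma and depth over a local ring *)

Section Local.
Variables (R : comNzRingType) (m : idealr R).
Hypotheses (R_noeth : noetherian R) (R_local : local_ring m).
Implicit Types (I J P Q : set R) (a b x y z : R).

Lemma proper_sub_local I : ideal I -> ~ I 1 -> {in I, forall x, x \in m}.
Proof.
move=> I_id I1 x /set_mem Ix.
have [||M [[M_id [M1 IM]] M_max]] :=
  ideal_maximal R_noeth (F := [set J | ideal J /\ (~ J 1 /\ I `<=` J)]).
- by move=> J [].
- by exists I; split=> //; split=> //; apply: subset_refl.
have M_maximal : maximal_ideal (pack_idealr M_id M1).
  move=> J MJ y Jy; apply/pack_idealrE.
  rewrite -(M_max [set x | x \in J]) //.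
    split; first exact: idealr_ideal.
    split=> [|z Iz] /=; first by rewrite idealr1.
    by apply: MJ; apply/pack_idealrE/IM.
  by move=> z Mz; apply: MJ; apply/pack_idealrE.
by rewrite -(R_local.2 _ M_maximal); apply/pack_idealrE/IM.
Qed.

Lemma local_unit x : x \notin m -> exists y, y * x = 1.
Proof.
move=> xm; apply: contrapT => no_inv; move/negP: xm; apply.
have x_id := adj_ideal x (@ideal_set0 R).
apply: (proper_sub_local x_id); last by apply/mem_set/adj_gen/ideal_set0.
by move=> [j [b [-> E]]]; apply: no_inv; exists b; rewrite E add0r.
Qed.

Lemma unit_1B x : x \in m -> exists y, y * (1 - x) = 1.
Proof.
move=> xm; apply: local_unit; apply/negP => x1m.
by move: (idealr1 m); rewrite -(subrK x 1) rpredD.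
Qed.

(** Since 1 - c_0 is a unit, the first generator is, modulo W, a combination of the others;
    substituting it into the other relations keeps their coefficients in m. *)
Lemma nakayama (V : lmodType R) (W : set V) n (v : 'I_n -> V) : submodule W ->
  (forall i, exists2 c : 'I_n -> R,
     forall j, c j \in m & W (v i - \sum_j c j *: v j)) ->
  forall i, W (v i).
Proof.
move=> W_sub; elim: n v => [|n IHn] v vP; first by case.
have [c cm] := vP ord0; rewrite big_ord_recl => Wv0.
have [u uE] := unit_1B (cm ord0).
pose w := \sum_j (u * c (lift ord0 j)) *: v (lift ord0 j).
have {}Wv0 : W (v ord0 - w).
  suff -> : v ord0 - w = u *: (v ord0 -
      (c ord0 *: v ord0 + \sum_(i < n) c (lift ord0 i) *: v (lift ord0 i))).
    exact: submoduleZ.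
  rewrite opprD addrA -[X in X - c ord0 *: _]scale1r -scalerBl scalerBr scalerA uE scale1r.
  by rewrite scaler_sumr; congr (_ - _); apply: eq_bigr => j _; rewrite scalerA.
have Wv j : W (v (lift ord0 j)).
  move: j; apply: (IHn (fun j => v (lift ord0 j))) => i.
  have [d dm Wi] := vP (lift ord0 i).
  exists (fun j => d ord0 * (u * c (lift ord0 j)) + d (lift ord0 j)).
    by move=> j; rewrite rpredD // mulrC idealMr // mulrC.
  have -> : \sum_j (d ord0 * (u * c (lift ord0 j)) + d (lift ord0 j)) *: v (lift ord0 j)
      = d ord0 *: w + \sum_j d (lift ord0 j) *: v (lift ord0 j).
    rewrite scaler_sumr -big_split; apply: eq_bigr => j _ /=.
    by rewrite scalerDl !scalerA mulrA.
  rewrite big_ord_recl in Wi; have := submoduleD W_sub Wi (submoduleZ W_sub (d ord0) Wv0).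
  congr (W _); rewrite scalerBr addrA [d ord0 *: v ord0 + _]addrC opprD addrA subrK.
  by rewrite opprD addrA addrAC.
move=> i; case: (unliftP ord0 i) => [j ->|->]; first exact: Wv.
rewrite -(subrK w (v ord0)); apply: submoduleD => //.
by apply: submodule_sum => // j _; apply: submoduleZ.
Qed.

Lemma ideal_nakayama U J x : ideal U -> ideal J -> x \in m ->
  (forall u, U u -> exists j v, [/\ J j, U v & u = j + x * v]) -> U `<=` J.
Proof.
move=> U_id J_id xm UP; have [n [a aP]] := ideal_fg R_noeth U_id.
have Ja i : J (a i).
  apply: (nakayama (V := R^o) (W := J) (v := a)) => // {}i.
  have [|j [v [Jj Uv ->]]] := UP (a i).
    apply/aP; exists (fun j => (j == i)%:R).
    rewrite (bigD1 i) //= eqxx mul1r big1 ?addr0 // => j /negPf->.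
    by rewrite mul0r.
  have [c ->] : exists c, v = \sum_i c i * a i by apply/aP.
  exists (fun j => x * c j); first by move=> k; rewrite mulrC idealMr.
  have -> : \sum_k (x * c k) *: (a k : R^o) = x * \sum_k c k * a k.
    by rewrite mulr_sumr; apply: eq_bigr => k _; rewrite /GRing.scale /= mulrA.
  by rewrite addrK.
by move=> u /aP[c ->]; apply: ideal_sum => // i _; apply: idealM.
Qed.

(** If z kills u modulo J, then u = j + xb with b again killed by z, so (J : z) lies in J + x(J : z)
    and Nakayama puts it inside J. *)
Lemma nzd_swap J x z : ideal J -> x \in m -> nzd J x -> nzd (adj J x) z ->
  nzd J z /\ nzd (adj J z) x.
Proof.
move=> J_id xm Jx Jxz; split=> [a|b [j [c [Jj E]]]].
  move=> Jza; apply: (@ideal_nakayama (colon J z) J x) => //.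
  - exact: colon_ideal.
  - move=> u Jzu; have [|j [b [Jj uE]]] := Jxz u; first by apply/sub_adj; rewrite mulrC.
    exists j, b; split=> //; last by rewrite uE (mulrC b).
    apply: Jx; have -> : x * (b * z) = u * z - z * j by rewrite uE; ring.
    by apply: idealB => //; apply: idealM.
  - by rewrite /colon /= mulrC.
have [|j' [d [Jj' cE]]] := Jxz c.
  by exists (- j), b; split; [exact: idealN | rewrite (mulrC b) E; ring].
exists (b - d * z), d; split; last by rewrite subrK.
apply: Jx; have -> : x * (b - d * z) = j + z * j' by rewrite mulrBr E cE; ring.
by apply: idealD => //; apply: idealM.
Qed.

(* A regular sequence of length n on R/J, for which R/J = 0 is allowed. *)
Definition depth_ge J (n : nat) : Prop :=
  exists s : seq R, [/\ size s = n, {subset s <= m} & regular_mod J s].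

Lemma depth_ge_cons J x n : x \in m -> nzd J x -> depth_ge (adj J x) n ->
  depth_ge J n.+1.
Proof.
move=> xm Jx [s [sz sm s_reg]]; exists (x :: s); split=> /=; [by rewrite sz | | by split].
by move=> y; rewrite in_cons => /orP[/eqP->|/sm].
Qed.

Lemma depth_geS J n : depth_ge J n.+1 ->
  exists x, [/\ x \in m, nzd J x & depth_ge (adj J x) n].
Proof.
case=> -[|x s] [] //= [sz] sm [Jx s_reg]; exists x; split=> //.
  by apply: sm; rewrite mem_head.
by exists s; split=> // y ys; apply: sm; rewrite in_cons ys orbT.
Qed.

(* For n > 0 choose z in m regular on both R/(J + xR) and R/(J + yR), where x
   starts a regular sequence of length n + 1, and go through J + zR. *)
Lemma depth_ge_adj n J y : ideal J -> y \in m -> nzd J y ->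
  depth_ge J n.+1 -> depth_ge (adj J y) n.
Proof.
elim: n J y => [|n IHn] J y J_id ym Jy; first by exists [::].
case/depth_geS=> x [xm Jx Dx].
have m_id := idealr_ideal m.
have Jx_id := adj_ideal x J_id; have Jy_id := adj_ideal y J_id.
have [x2 [x2m Jx2 _]] := depth_geS Dx.
have no_socle_x b : [set x | x \in m] `<=` colon (adj J x) b -> adj J x b.
  by move=> sub; apply/Jx2/sub.
have [[z [zm Jxz Jyz]]|] := common_nzd R_noeth m_id Jx_id Jy_id; last first.
  case=> [[b nb /no_socle_x //]|[a na sub]].
  (* Socle transfer: m kills the class of a modulo J + yR. Writing xa = j + by, cancellation of y
     shows that m kills b modulo J + xR, where [x2] is regular, so b lies in J + xR; cancelling x
     then puts a in J + yR. *)
  case: na; have [j [b [Jj xaE]]] : adj J y (x * a) by apply: sub.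
  have [|j2 [c [Jj2 bE]]] := no_socle_x b.
    move=> r rm; have [j1 [b1 [Jj1 raE]]] : adj J y (r * a) by apply: sub.
    exists (r * b - b1 * x), b1; split; last by rewrite subrK.
    apply: Jy; have -> : y * (r * b - b1 * x) = x * j1 - r * j.
      have -> : j1 = r * a - b1 * y by rewrite raE addrK.
      have -> : j = x * a - b * y by rewrite xaE addrK.
      ring.
    by apply: idealB => //; apply: idealM.
  exists (a - c * y), c; split; last by rewrite subrK.
  apply: Jx; have -> : x * (a - c * y) = j + y * j2 by rewrite mulrBr xaE bE; ring.
  by apply: idealD => //; apply: idealM.
have [Jz Jzx] := nzd_swap J_id xm Jx Jxz.
have Jz_id := adj_ideal z J_id.
have Dxz := IHn _ _ Jx_id zm Jxz Dx.
have Dz : depth_ge (adj J z) n.+1.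
  by apply: depth_ge_cons Jzx _ => //; rewrite adj_swap.
have [_ Jzy] := nzd_swap J_id ym Jy Jyz.
have := IHn _ _ Jz_id ym Jzy Dz.
by rewrite adj_swap; apply: depth_ge_cons.
Qed.

End Local.

(** * Chains of primes and regular sequences inside an ideal *)

Section Dimension.
Variables (R : comNzRingType) (m : idealr R).
Hypotheses (R_noeth : noetherian R) (R_local : local_ring m).
Implicit Types (I J P Q : set R) (a b x y z : R).

(* If P = (J : a) and U = (J : P), Nakayama gives u in U outside J + xR, and
   any associated prime of J + xR above (J + xR : u) contains P + xR. *)
Lemma prime_chain_from_associated n J P : ideal J -> depth_ge m J n ->
  associated J P ->
  exists C : nat -> prime_idealr R,
    prime_chain n C /\ forall x, x \in C 0%N <-> P x.
Proof.
elim: n J P => [|n IHn] J P J_id Dn [P_pr [a [Ja PE]]].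
  by exists (fun=> pack_prime P_pr); split=> // x; apply: pack_primeE.
have [x [xm Jx Dx]] := depth_geS Dn.
have Jx_id := adj_ideal x J_id.
pose U := [set u | P `<=` colon J u].
have U_id : ideal U.
  split=> [p _|r u v Uu Uv p Pp]; first by rewrite /colon /= mulr0; apply: ideal0.
  rewrite /colon /= mulrDr; apply: (idealD J_id); last exact: Uv.
  by rewrite /GRing.scale /= mulrCA; apply: idealM => //; apply: Uu.
(* If U were inside J + xR, each u would be j + xb with b again in U, because Pu lies in J and x
   cancels; Nakayama would put U, and with it a, inside J. *)
have [u Uu xu] : exists2 u, U u & ~ adj J x u.
  apply: contrapT => noU; apply: Ja.
  apply: (@ideal_nakayama _ _ R_noeth R_local U J x) => //; last by rewrite /U /= PE.
  move=> u Uu; have [j [b [Jj uE]]] : adj J x u.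
    by apply: contrapT => nu; apply: noU; exists u.
  exists j, b; split=> //; last by rewrite uE mulrC.
  move=> p Pp; apply: Jx; have -> : x * (p * b) = p * u - p * j by rewrite uE; ring.
  by apply: (idealB J_id); [apply: Uu | apply: idealM].
have [Q QA subQ] := associated_above R_noeth Jx_id xu.
have [C [C_chain C0]] := IHn _ _ Jx_id Dx QA.
exists (fun i => if i is j.+1 then C j else pack_prime P_pr); split; last exact: pack_primeE.
case=> [|i] lti /=; last exact: C_chain.
(* Strictness comes from x: it lies in [C 0], but it is regular on R/J and so cannot lie in P = (J :
   a). *)
split=> [p /(pack_primeE P_pr) Pp|sub].
  by apply/C0; apply: subQ; apply: sub_adj; apply: Uu.
have /sub/(pack_primeE P_pr) : x \in C 0%N.
  by apply/C0/subQ; rewrite /colon /= mulrC; apply: adj_mul.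
by rewrite PE => /Jx.
Qed.

Lemma regular_mod_in_ideal I d t n J : ideal I -> {in I, forall x, x \in m} ->
  (forall (k : nat) (C : nat -> prime_idealr R), prime_chain k C ->
     (forall x, I x -> x \in C 0%N) -> (k <= d)%N) ->
  ideal J -> depth_ge m J n -> (t + d <= n)%N ->
  exists s : seq R, [/\ size s = t, {in s, forall x, I x} & regular_mod J s].
Proof.
move=> I_id Im dimI; elim: t n J => [|t IHt] n J J_id Dn ltn; first by exists [::].
have [y [Iy Jy]] : exists y, I y /\ nzd J y.
  have [[y [Iy Jy _]]|] := common_nzd R_noeth I_id J_id J_id; first by exists y.
  suff no b : ~ J b -> I `<=` colon J b -> False by case=> -[b /no].
  move=> /(associated_above R_noeth J_id)[P PA subP] subI.
  have [C [C_chain C0]] := prime_chain_from_associated J_id Dn PA.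
  have : (n <= d)%N by apply: dimI C_chain _ => x Ix; apply/C0/subP/subI.
  by move=> /(leq_trans ltn); rewrite addSn -ltnS ltnS ltnNge leq_addl.
case: n Dn ltn => [|n] Dn //; rewrite addSn ltnS => ltn.
have ym : y \in m by apply: Im; apply/mem_set.
have Dy := depth_ge_adj R_noeth R_local J_id ym Jy Dn.
have [s [sz sI s_reg]] := IHt _ _ (adj_ideal y J_id) Dy ltn.
exists (y :: s); split=> //=; first by rewrite sz.
by move=> z; rewrite in_cons => /orP[/eqP->|/sI].
Qed.

End Dimension.

(** * Null-homotopies and vanishing of Ext *)

Section Resolutions.
Variable R : comNzRingType.

Lemma factor_rows b c k (A : 'M[R]_(k, c)) (D : 'M[R]_(b, c)) :
  (forall i, exists w, row i A = w *m D) -> exists h, A = h *m D.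
Proof.
case/choice=> w wP; exists (\matrix_i w i); apply/row_matrixP => i.
by rewrite row_mul rowK.
Qed.

Variables (L : lmodType R) (F : free_resolution L).

Lemma diff_diff i : diff F i.+1 *m diff F i = 0.
Proof.
apply/row_matrixP => j; rewrite row0 row_mul; apply/diff_exact.
by exists (delta_mx 0 j); rewrite -rowE.
Qed.

Lemma aug_diff u : aug F (u *m diff F 0) = 0.
Proof. by apply/aug_exact; exists u. Qed.

Lemma factor_aug k (A : 'M[R]_(k, rk F 0)) :
  (forall u, aug F (u *m A) = 0) -> exists h, A = h *m diff F 0.
Proof.
move=> A0; apply: factor_rows => i.
by have /aug_exact[w wE] := A0 (delta_mx 0 i); exists w; rewrite rowE.
Qed.

Lemma factor_diff i k (A : 'M[R]_(k, rk F i.+1)) :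
  A *m diff F i = 0 -> exists h, A = h *m diff F i.+1.
Proof.
move=> A0; apply: factor_rows => j; apply/diff_exact.
by rewrite -row_mul A0 row0.
Qed.

Section NullHomotopy.
Variable phi : forall i, 'M[R]_(rk F i).
Hypothesis phi_chain : forall i, phi i.+1 *m diff F i = diff F i *m phi i.
Hypothesis phi_aug : forall u, aug F (u *m phi 0) = 0.

Lemma null_homotopic0 : exists h, phi 0 = h *m diff F 0.
Proof. exact: factor_aug. Qed.

(** The upper homotopy [h'] of one degree serves as the lower one of the next: what remains of phi
    after subtracting its contribution is killed by the differential, hence factors through the
    following one. *)
Lemma null_homotopic i :
  exists h h', phi i.+1 = h' *m diff F i.+1 + diff F i *m h.
Proof.
elim: i => [|i [h [h' phiE]]].
  have [h hE] := null_homotopic0; exists h.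
  have [|h' h'E] := @factor_diff 0 _ (phi 1 - diff F 0 *m h); last by exists h'; rewrite -h'E subrK.
  by rewrite mulmxBl phi_chain -mulmxA -hE subrr.
exists h'.
have [|h'' h''E] := @factor_diff i.+1 _ (phi i.+2 - diff F i.+1 *m h').
  by rewrite mulmxBl phi_chain phiE mulmxDr !mulmxA diff_diff mul0mx addr0 subrr.
by exists h''; rewrite -h''E subrK.
Qed.

End NullHomotopy.

(** Columns are the cochains of Hom(F, R), on which [diff F i] acts from the left; this is vanishing
    in Hom(F, R/J). *)
Definition zero_mod n (J : set R) (f : 'cV[R]_n) : Prop := forall j, J (f j 0).

Lemma zero_mod_mul n k (J : set R) (A : 'M[R]_(k, n)) (f : 'cV[R]_n) :
  ideal J -> zero_mod J f -> zero_mod J (A *m f).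
Proof.
by move=> J_id Jf j; rewrite mxE; apply: ideal_sum => // i _; apply: idealM.
Qed.

Lemma zero_modD n (J : set R) (f g : 'cV[R]_n) :
  ideal J -> zero_mod J f -> zero_mod J g -> zero_mod J (f + g).
Proof. by move=> J_id Jf Jg j; rewrite mxE; apply: idealD. Qed.

Lemma zero_mod_adj n (J : set R) y (f : 'cV[R]_n) : ideal J ->
  zero_mod (adj J y) f -> exists e, zero_mod J (f - y *: e).
Proof.
move=> J_id Jf; have : forall j, exists b, J (f j 0 - b * y).
  by move=> j; have [c [b [Jc ->]]] := Jf j; exists b; rewrite addrK.
by case/choice=> b bP; exists (\col_j b j) => j; rewrite !mxE mulrC.
Qed.

Lemma zero_mod_nzd n (J : set R) y (f : 'cV[R]_n) :
  nzd J y -> zero_mod J (y *: f) -> zero_mod J f.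
Proof. by move=> Jy Jf j; apply: Jy; have := Jf j; rewrite mxE. Qed.

(* Multiplication by an element y killing L is null-homotopic on F, so y f is
   a coboundary modulo J; its primitive is a cocycle modulo J + yR. *)
Lemma cocycle_mod_regular (s : seq R) (J : set R) : ideal J ->
  {in s, forall y, forall x : L, y *: x = 0} -> regular_mod J s ->
  forall i, (i < size s)%N -> forall f : 'cV[R]_(rk F i),
    zero_mod J (diff F i *m f) ->
    match i return 'cV[R]_(rk F i) -> Prop with
    | 0 => zero_mod J
    | k.+1 => fun f => exists g : 'cV[R]_(rk F k), zero_mod J (f - diff F k *m g)
    end f.
Proof.
elim: s J => [|y s IHs] J J_id sL; first by [].
move=> [Jy s_reg] i ltis f Jf.
pose phi k : 'M[R]_(rk F k) := y%:M.
have phi_chain k : phi k.+1 *m diff F k = diff F k *m phi k.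
  by rewrite mul_scalar_mx mul_mx_scalar.
have phi_aug u : aug F (u *m phi 0) = 0.
  by rewrite mul_mx_scalar linearZ; apply: (sL y (mem_head _ _)).
case: i ltis f Jf => [_|k ltks] f Jf.
  have [h hE] := null_homotopic0 phi_aug.
  apply: zero_mod_nzd Jy _; rewrite -mul_scalar_mx -/(phi 0) hE -mulmxA.
  exact: zero_mod_mul.
have [h [h' hE]] := null_homotopic phi_chain phi_aug k.
have yfE : y *: f = h' *m (diff F k.+1 *m f) + diff F k *m (h *m f).
  by rewrite -mul_scalar_mx -/(phi k.+1) hE mulmxDl !mulmxA.
have Jy_id := adj_ideal y J_id.
have Jyhf : zero_mod (adj J y) (diff F k *m (h *m f)).
  have -> : diff F k *m (h *m f) = y *: f - h' *m (diff F k.+1 *m f).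
    by rewrite yfE addrAC subrr add0r.
  move=> j; rewrite !mxE; apply: (idealB Jy_id); first by rewrite mulrC; apply: adj_mul.
  apply: sub_adj; have := zero_mod_mul h' J_id Jf j; by rewrite mxE.
(* By induction on the sequence, hf is a coboundary modulo J + yR (zero when k = 0). The
   differential kills the coboundary, which leaves a multiple of y modulo J. *)
have [e Je] : exists e, zero_mod J (diff F k *m (h *m f) - y *: (diff F k *m e)).
  have sL' : {in s, forall y, forall x : L, y *: x = 0}.
    by move=> z zs; apply: sL; rewrite in_cons zs orbT.
  have := IHs _ Jy_id sL' s_reg k ltks _ Jyhf.
  case: (k) (h *m f) => [|k'] g /=.
    move=> /(zero_mod_adj J_id)[e Je]; exists e.
    by rewrite scalemxAr -mulmxBr; apply: zero_mod_mul.
  case=> g' /(zero_mod_adj J_id)[e Je]; exists e.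
  have -> : diff F k'.+1 *m g - y *: (diff F k'.+1 *m e)
      = diff F k'.+1 *m (g - diff F k' *m g' - y *: e).
    by rewrite !mulmxBr mulmxA diff_diff mul0mx subr0 scalemxAr.
  exact: zero_mod_mul.
exists e; apply: zero_mod_nzd Jy _.
rewrite scalerBr yfE -addrA; apply: zero_modD => //.
exact: zero_mod_mul.
Qed.

Lemma Ext_zero_regular (s : seq R) i :
  {in s, forall y, forall x : L, y *: x = 0} -> regular_mod [set 0] s ->
  (i < size s)%N -> @Ext_zero R i L R^o.
Proof.
move=> sL s_reg lti; exists F.
have zero_modE n (f : 'cV[R]_n) : zero_mod [set 0] f <-> f = 0.
  split=> [f0|-> j]; last by rewrite mxE.
  by apply/matrixP => j k; rewrite ord1 f0 mxE.
pose col_of n (f : {linear 'rV[R]_n -> R^o}) : 'cV[R]_n := \col_j f (delta_mx 0 j).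
have col_ofE n (f : {linear 'rV[R]_n -> R^o}) u : f u = (u *m col_of n f) 0 0.
  rewrite {1}[u]row_sum_delta linear_sum mxE; apply: eq_bigr => j _.
  by rewrite linearZ mxE.
have := cocycle_mod_regular (@ideal_set0 R) sL s_reg lti.
have cocycle k (f : {linear 'rV[R]_(rk F k) -> R^o}) :
    (forall u, f (u *m diff F k) = 0) -> zero_mod [set 0] (diff F k *m col_of _ f).
  move=> f0; apply/zero_modE/colP => j; rewrite [RHS]mxE -[RHS](f0 (delta_mx 0 j)) col_ofE.
  by rewrite -mulmxA -rowE [RHS]mxE.
case: i {lti} => [|k] H f f0.
  move=> u; rewrite col_ofE; move/zero_modE: (H _ (cocycle _ _ f0)) => ->.
  by rewrite mulmx0 mxE.
have [g /zero_modE/eqP] := H _ (cocycle _ _ f0); rewrite subr_eq0 => /eqP fE.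
pose g_fun (u : 'rV[R]_(rk F k)) : R^o := (u *m g) 0 0.
have g_lin : linear g_fun by move=> a u v; rewrite /g_fun mulmxDl -scalemxAl !mxE.
pose g_linear := HB.pack g_fun (GRing.isLinear.Build _ _ _ _ g_fun g_lin)
  : {linear 'rV[R]_(rk F k) -> R^o}.
exists g_linear => u /=.
by rewrite col_ofE fE /g_fun mulmxA.
Qed.

End Resolutions.

(** * Existence of resolutions by finite free modules *)

Section Existence.
Variable R : comNzRingType.
Hypothesis R_noeth : noetherian R.

(** Induction on b: the first coordinates of S form an ideal, and the elements with first coordinate
    0 form a submodule of smaller rank. Lifts of generators of the former ([A]) and generators of
    the latter ([D]) together generate S. *)
Lemma submodule_rV_fg b (S : set 'rV[R]_b) : submodule S ->
  exists p (D : 'M[R]_(p, b)), forall u, S u <-> exists w, u = w *m D.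
Proof.
elim: b S => [|b IHb] S S_sub.
  exists 0%N, 0 => u; rewrite (thinmx0 u); split=> _; last exact: submodule0.
  by exists 0; rewrite mul0mx.
move: S S_sub; rewrite -[b.+1]/(1 + b)%N => S S_sub.
pose I : set R := [set x | exists v : 'rV[R]_b, S (row_mx x%:M v)].
have I_id : ideal I.
  split=> [|a x y [v Sv] [w Sw]].
    by exists 0; rewrite raddf0 row_mx0; apply: submodule0.
  exists (a *: v + w); have := S_sub.2 a _ _ Sv Sw.
  by rewrite scale_row_mx add_row_mx scale_scalar_mx -raddfD.
have [n [a aP]] := ideal_fg R_noeth I_id.
have : forall i, exists v : 'rV[R]_b, S (row_mx (a i)%:M v).
  move=> i; suff : I (a i) by [].
  apply/aP; exists (fun j => (j == i)%:R).
  rewrite (bigD1 i) //= eqxx mul1r big1 ?addr0 // => j /negPf->.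
  by rewrite mul0r.
case/choice=> v vP.
have [|p [D DP]] := IHb [set w | S (row_mx 0 w)].
  split=> [|c u w Su Sw] /=; first by rewrite row_mx0; apply: submodule0.
  by have := S_sub.2 c _ _ Su Sw; rewrite scale_row_mx add_row_mx scaler0 addr0.
pose A := row_mx (\col_i a i) (\matrix_i v i).
have SA (c : 'rV_n) : S (c *m A).
  rewrite mulmx_sum_row; apply: submodule_sum => // i _.
  apply: submoduleZ => //; rewrite row_row_mx rowK.
  suff -> : row i (\col_i a i) = (a i)%:M by [].
  by rewrite [LHS]mx11_scalar !mxE.
exists (n + p)%N, (col_mx A (row_mx 0 D)) => u; split; last first.
  case=> w ->; rewrite -[w]hsubmxK mul_row_col; apply: submoduleD => //.
  by rewrite mul_mx_row mulmx0; apply/DP; exists (rsubmx w).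
move=> Su.
have [c cE] : exists c : 'I_n -> R, lsubmx u 0 0 = \sum_i c i * a i.
  by apply/aP; exists (rsubmx u); rewrite -mx11_scalar hsubmxK.
pose cA := (\row_i c i) *m A.
have uE : u - cA = row_mx 0 (rsubmx (u - cA)).
  rewrite -[LHS]hsubmxK; congr row_mx; rewrite linearB /= /cA mul_mx_row row_mxKl.
  rewrite [LHS]mx11_scalar mxE cE mxE (_ : _ - _ = 0) ?raddf0 //.
  by apply/eqP; rewrite subr_eq0 mxE; apply/eqP/eq_bigr => i _; rewrite !mxE.
have [w wE] : exists w, rsubmx (u - cA) = w *m D.
  by apply/DP; rewrite /= -uE; exact: (submoduleB S_sub Su (SA _)).
exists (row_mx (\row_i c i) w); rewrite mul_row_col [w *m _]mul_mx_row mulmx0 -wE -uE -/cA.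
by rewrite addrC subrK.
Qed.

Lemma syzygies b c (D : 'M[R]_(b, c)) :
  {p : nat & {E : 'M[R]_(p, b) |
    forall u : 'rV[R]_b, u *m D = 0 <-> exists w, u = w *m E}}.
Proof.
have [|p /cid[E EP]] := cid (submodule_rV_fg (S := [set u : 'rV[R]_b | u *m D = 0]) _).
  split=> [|a u v /= uD vD]; first by rewrite /= mul0mx.
  by rewrite mulmxDl -scalemxAl uD vD scaler0 addr0.
by exists p; exists E.
Qed.

Section Resolution.
Variables (L : lmodType R) (b0 c0 : nat) (D0 : 'M[R]_(b0, c0)).
Variable f : {linear 'rV[R]_c0 -> L}.
Hypothesis f_surj : forall x : L, exists u, f u = x.
Hypothesis f_exact : forall u, f u = 0 <-> exists w, u = w *m D0.

(** Each matrix travels with its size, which is known only once syzygies are chosen. The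
    presentation [D0] is a parameter so that a resolution of R/(x) can be made to start with the
    column x. *)
Fixpoint resolution_step (i : nat) : {b : nat & {c : nat & 'M[R]_(b, c)}} :=
  if i is j.+1 then
    let s := resolution_step j in
    let E := syzygies (projT2 (projT2 s)) in
    existT _ (projT1 E) (existT _ (projT1 s) (sval (projT2 E)))
  else existT _ b0 (existT _ c0 D0).

Definition resolution_rk (i : nat) : nat :=
  if i is j.+1 then projT1 (resolution_step j) else c0.

Definition resolution_diff (i : nat) : 'M[R]_(resolution_rk i.+1, resolution_rk i) :=
  match i with
  | 0 => D0
  | j.+1 => projT2 (projT2 (resolution_step j.+1))
  end.

Lemma resolution_exact i (u : 'rV[R]_(resolution_rk i.+1)) :
  u *m resolution_diff i = 0 <-> exists w, u = w *m resolution_diff i.+1.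
Proof.
case: i u => [|i] u; first exact: (svalP (projT2 (syzygies D0))).
exact: (svalP (projT2 (syzygies (resolution_diff i.+1)))).
Qed.

Definition resolution : free_resolution L :=
  @FreeResolution R L resolution_rk resolution_diff f f_surj f_exact resolution_exact.

End Resolution.

Lemma resolution_exists (L : lmodType R) : finitely_generated L ->
  inhabited (free_resolution L).
Proof.
case=> n [g gP]; pose f_fun (u : 'rV[R]_n) : L := \sum_i u 0 i *: g i.
have f_lin : linear f_fun.
  move=> a u v; rewrite /f_fun scaler_sumr -big_split; apply: eq_bigr => i _ /=.
  by rewrite !mxE scalerDl scalerA.
pose f := HB.pack f_fun (GRing.isLinear.Build _ _ _ _ f_fun f_lin)
  : {linear 'rV[R]_n -> L}.
have f_surj x : exists u, f u = x.
  have [c ->] := gP x; exists (\row_i c i); apply: eq_bigr => i _.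
  by rewrite mxE.
have [|p [D DP]] := submodule_rV_fg (S := [set u | f u = 0]).
  split=> [|a u v fu fv]; first exact: linear0.
  by move: fu fv => /= fu fv; rewrite f_lin fu fv scaler0 addr0.
by split; apply: (resolution (D0 := D) (f := f)).
Qed.

End Existence.

(** * Independence of Tor from the resolution *)

Section Comparison.
Variable R : comNzRingType.

Lemma dependent_sequence (T : nat -> Type) (P : forall i, T i -> Prop)
    (Q : forall i, T i -> T i.+1 -> Prop) (x0 : T 0%N) : P 0%N x0 ->
  (forall i x, P i x -> exists y, Q i x y /\ P i.+1 y) ->
  exists g : forall i, T i, g 0%N = x0 /\ forall i, Q i (g i) (g i.+1).
Proof.
move=> Px0 step.
have next i (x : {x | P i x}) : {y : {y | P i.+1 y} | Q i (sval x) (sval y)}.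
  case: x => x Pix; have [y [Qxy Py]] := cid (step i x Pix).
  by exists (exist _ y Py).
pose h i := nat_rect (fun i => {x | P i x}) (exist _ x0 Px0)
  (fun i x => sval (next i x)) i.
exists (fun i => sval (h i)); split=> // i.
exact: (svalP (next i (h i))).
Qed.

Lemma chain_map_exists (L : lmodType R) (F G : free_resolution L) :
  exists a : forall i, 'M[R]_(rk F i, rk G i),
    (forall u, aug G (u *m a 0%N) = aug F u) /\
    forall i, a i.+1 *m diff G i = diff F i *m a i.
Proof.
have /choice[w wP] : forall j, exists w, aug G w = aug F (delta_mx 0 j).
  by move=> j; apply: aug_surj.
have a0P u : aug G (u *m \matrix_j w j) = aug F u.
  rewrite mulmx_sum_row linear_sum [in RHS](row_sum_delta u) linear_sum.
  by apply: eq_bigr => j _; rewrite rowK !linearZ wP.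
(* The invariant, that [diff F i *m A] factors through [diff G i], is what allows the next component
   to be chosen. *)
have [||a [aE a_chain]] := @dependent_sequence (fun i => 'M[R]_(rk F i, rk G i))
  (fun i A => exists B, diff F i *m A = B *m diff G i)
  (fun i A B => B *m diff G i = diff F i *m A) (\matrix_j w j).
- by apply: factor_aug => u; rewrite mulmxA a0P aug_diff.
- move=> i A [B AB]; exists B; split=> //; apply: factor_diff.
  by rewrite -mulmxA -AB mulmxA diff_diff mul0mx.
by exists a; split=> // u; rewrite aE.
Qed.

Variable N : lmodType R.

Lemma tens_mxM b c d (A : 'M[R]_(b, c)) (B : 'M[R]_(c, d)) (v : {ffun 'I_b -> N}) :
  tens_mx (A *m B) v = tens_mx B (tens_mx A v).
Proof.
apply/ffunP => j; rewrite !ffunE.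
under [RHS]eq_bigr do rewrite ffunE scaler_sumr.
rewrite exchange_big; apply: eq_bigr => i _ /=.
by rewrite mxE scaler_suml; apply: eq_bigr => k _; rewrite scalerA mulrC.
Qed.

Lemma tens_mxDl b c (A B : 'M[R]_(b, c)) (v : {ffun 'I_b -> N}) :
  tens_mx (A + B) v = tens_mx A v + tens_mx B v.
Proof.
apply/ffunP => j; rewrite !ffunE -big_split; apply: eq_bigr => i _ /=.
by rewrite mxE scalerDl.
Qed.

Lemma tens_mxDr b c (A : 'M[R]_(b, c)) (v w : {ffun 'I_b -> N}) :
  tens_mx A (v + w) = tens_mx A v + tens_mx A w.
Proof.
apply/ffunP => j; rewrite !ffunE -big_split; apply: eq_bigr => i _ /=.
by rewrite ffunE scalerDr.
Qed.

Lemma tens_mxZl b c a (A : 'M[R]_(b, c)) (v : {ffun 'I_b -> N}) :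
  tens_mx (a *: A) v = a *: tens_mx A v.
Proof.
apply/ffunP => j; rewrite !ffunE scaler_sumr; apply: eq_bigr => i _ /=.
by rewrite mxE scalerA.
Qed.

Lemma tens_mxZr b c a (A : 'M[R]_(b, c)) (v : {ffun 'I_b -> N}) :
  tens_mx A (a *: v) = a *: tens_mx A v.
Proof.
apply/ffunP => j; rewrite !ffunE scaler_sumr; apply: eq_bigr => i _ /=.
by rewrite ffunE !scalerA mulrC.
Qed.

Lemma tens_mx0l b c (v : {ffun 'I_b -> N}) : tens_mx (0 : 'M[R]_(b, c)) v = 0.
Proof. by apply/ffunP => j; rewrite !ffunE big1 // => i _; rewrite mxE scale0r. Qed.

Lemma tens_mx0r b c (A : 'M[R]_(b, c)) : tens_mx A (0 : {ffun 'I_b -> N}) = 0.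
Proof. by apply/ffunP => j; rewrite !ffunE big1 // => i _; rewrite ffunE scaler0. Qed.

Lemma tens_mxNr b c (A : 'M[R]_(b, c)) (v : {ffun 'I_b -> N}) :
  tens_mx A (- v) = - tens_mx A v.
Proof. by rewrite -scaleN1r tens_mxZr scaleN1r. Qed.

Lemma tens_mx1 b (v : {ffun 'I_b -> N}) : tens_mx 1%:M v = v.
Proof.
apply/ffunP => j; rewrite ffunE (bigD1 j) //= big1 => [|i /negPf ij].
  by rewrite mxE eqxx scale1r addr0.
by rewrite mxE ij scale0r.
Qed.

(** The composite G -> F -> G lifts the identity of L, so it is homotopic to the identity: a cycle v
    differs from its image by a boundary, and that image is a boundary because it passes through N
    (x) F. *)
Lemma Tor_homology_zero_independent (L : lmodType R) (F G : free_resolution L) n :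
  Tor_homology_zero N F n.+1 -> Tor_homology_zero N G n.+1.
Proof.
move=> F0 v dv.
have [a [a_aug a_chain]] := chain_map_exists F G.
have [b [b_aug b_chain]] := chain_map_exists G F.
pose phi i : 'M[R]_(rk G i) := 1%:M - b i *m a i.
have phi_chain i : phi i.+1 *m diff G i = diff G i *m phi i.
  by rewrite mulmxBl mulmxBr mul1mx mulmx1 -mulmxA a_chain !mulmxA b_chain.
have phi_aug u : aug G (u *m phi 0) = 0.
  by rewrite mulmxBr mulmx1 linearB /= mulmxA a_aug b_aug subrr.
have [h [h' hE]] := null_homotopic phi_chain phi_aug n.
have [w wE] : exists w, tens_mx (b n.+1) v = tens_mx (diff F n.+1) w.
  by apply: F0; rewrite -tens_mxM b_chain tens_mxM dv tens_mx0r.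
exists (tens_mx h' v + tens_mx (a n.+2) w).
have {1}-> : v = tens_mx (phi n.+1) v + tens_mx (b n.+1 *m a n.+1) v.
  by rewrite -tens_mxDl subrK tens_mx1.
rewrite hE tens_mxDl !tens_mxM dv tens_mx0r addr0 wE tens_mxDr; congr (_ + _).
by rewrite -!tens_mxM a_chain.
Qed.

End Comparison.

(** * The cyclic modules R/I *)

Definition quot_module (R : comNzRingType) (I : idealr R) : Type := {ideal_quot I}.

HB.instance Definition _ (R : comNzRingType) (I : idealr R) :=
  GRing.Zmodule.copy (quot_module I) {ideal_quot I}.

Section QuotModule.
Variables (R : comNzRingType) (I : idealr R).
Local Open Scope quotient_scope.

Definition quot_proj (a : R) : quot_module I := \pi_({ideal_quot I}) a.

Definition quot_scale (a : R) (x : quot_module I) : quot_module I :=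
  (\pi_({ideal_quot I}) a * (x : {ideal_quot I})).

Lemma quot_scaleA a b x : quot_scale a (quot_scale b x) = quot_scale (a * b) x.
Proof. by rewrite /quot_scale rmorphM mulrA. Qed.

Lemma quot_scale1 : left_id 1 quot_scale.
Proof. by move=> x; rewrite /quot_scale rmorph1 mul1r. Qed.

Lemma quot_scaleDr : right_distributive quot_scale +%R.
Proof. by move=> a x y; apply: mulrDr. Qed.

Lemma quot_scaleDl x : {morph quot_scale^~ x : a b / a + b}.
Proof. by move=> a b; rewrite /quot_scale rmorphD; apply: mulrDl. Qed.

HB.instance Definition _ := GRing.Zmodule_isLmodule.Build R (quot_module I)
  quot_scaleA quot_scale1 quot_scaleDr quot_scaleDl.

Definition quot_aug (u : 'rV[R]_1) : quot_module I := quot_proj (u 0 0).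

Lemma quot_aug_linear : linear quot_aug.
Proof.
move=> a u v; rewrite /quot_aug /quot_proj !mxE rmorphD rmorphM.
by [].
Qed.

HB.instance Definition _ := GRing.isLinear.Build R 'rV[R]_1 (quot_module I) _
  quot_aug quot_aug_linear.

Lemma quot_aug_surj x : exists u, quot_aug u = x.
Proof.
by exists (repr (x : {ideal_quot I}))%:M; rewrite /quot_aug mxE mulr1n /quot_proj reprK.
Qed.

Lemma quot_aug_eq0 u : quot_aug u = 0 <-> u 0 0 \in I.
Proof.
rewrite -[X in X \in I]subr0 Quotient.idealrBE.
rewrite (rmorph0 (\pi_({ideal_quot I}))); by split=> [E|/eqP E]; [apply/eqP; exact: E | exact: E].
Qed.

Lemma quot_module_fg : finitely_generated (quot_module I).
Proof.
exists 1%N, (fun=> quot_proj 1) => x; have [u <-] := quot_aug_surj x.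
exists (fun i => u 0 i); rewrite big_ord1 /quot_aug -[in LHS](mulr1 (u 0 0)).
by rewrite /quot_proj rmorphM.
Qed.

End QuotModule.

(* The generators in reverse order, so that the newest one sits in row 0. *)
Fixpoint gen_col (R : comNzRingType) (x : nat -> R) (r : nat) : 'cV[R]_r :=
  if r is k.+1 then col_mx (x k)%:M (gen_col x k) : 'cV_(1 + k) else 0.

Definition gen_ideal (R : comNzRingType) (x : nat -> R) (r : nat) : set R :=
  [set y | exists c : 'rV[R]_r, (c *m gen_col x r) 0 0 = y].

Definition gen_mul (R : comNzRingType) (N : lmodType R) (x : nat -> R) (r : nat) : set N :=
  [set y | exists z : {ffun 'I_r -> N}, tens_mx (gen_col x r) z = [ffun=> y]].

(** * Relations with coefficients in N and Koszul syzygies *)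

Section Rigid.
Variables (R : comNzRingType) (x : nat -> R).

Lemma gen_ideal_ideal r : ideal (gen_ideal x r).
Proof.
split=> [|a _ _ [c <-] [d <-]]; first by exists 0; rewrite mul0mx mxE.
by exists (a *: c + d); rewrite mulmxDl -scalemxAl !mxE.
Qed.

Lemma gen_ideal_col r j : gen_ideal x r (gen_col x r j 0).
Proof. by exists (delta_mx 0 j); rewrite -rowE mxE. Qed.

Lemma gen_ideal_min r (I : set R) : ideal I -> (forall i, (i < r)%N -> I (x i)) ->
  gen_ideal x r `<=` I.
Proof.
move=> I_id; elim: r => [|r IHr] Ix _ [c <-]; first by rewrite thinmx0 mul0mx mxE; apply: ideal0.
rewrite -[c](@hsubmxK _ 1 1 r) (@mul_row_col _ 1 1 r) mxE; apply: idealD => //.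
  by rewrite mul_mx_scalar mxE; apply: idealMl => //; apply: Ix.
by apply: IHr => [i ir|]; [apply: Ix; apply: ltnW | exists (@rsubmx _ 1 1 r c)].
Qed.

Lemma gen_ideal_adj r : gen_ideal x r.+1 = adj (gen_ideal x r) (x r).
Proof.
apply/seteqP; split=> [_ [c <-]|_ [_ [b [[c <-] ->]]]].
  rewrite -[c](@hsubmxK _ 1 1 r) (@mul_row_col _ 1 1 r) mul_mx_scalar !mxE.
  exists ((@rsubmx _ 1 1 r c *m gen_col x r) 0 0), (@lsubmx _ 1 1 r c 0 0).
  by split; [exists (@rsubmx _ 1 1 r c) | rewrite !mxE addrC mulrC].
exists (@row_mx _ 1 1 r b%:M c); rewrite (@mul_row_col _ 1 1 r) mul_mx_scalar !mxE.
by rewrite mulr1n addrC mulrC.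
Qed.

Variable N : lmodType R.

Lemma tens_mx_col_mx a b c (A : 'M[R]_(a, c)) (B : 'M[R]_(b, c)) (v : {ffun 'I_(a + b) -> N}) :
  tens_mx (col_mx A B) v =
    tens_mx A [ffun i => v (lshift b i)] + tens_mx B [ffun i => v (rshift a i)].
Proof.
apply/ffunP => j; rewrite !ffunE big_split_ord; congr (_ + _).
  by apply: eq_bigr => i _; rewrite col_mxEu ffunE.
by apply: eq_bigr => i _; rewrite col_mxEd ffunE.
Qed.

Definition ffun_cat a b (v : {ffun 'I_a -> N}) (w : {ffun 'I_b -> N}) : {ffun 'I_(a + b) -> N} :=
  [ffun i => match split i with inl j => v j | inr j => w j end].

Lemma tens_mx_cat a b c (A : 'M[R]_(a, c)) (B : 'M[R]_(b, c)) v w :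
  tens_mx (col_mx A B) (ffun_cat v w) = tens_mx A v + tens_mx B w.
Proof.
rewrite tens_mx_col_mx; congr (_ + _); congr (tens_mx _ _).
  by apply/ffunP => i; rewrite !ffunE (unsplitK (inl _)).
by apply/ffunP => i; rewrite !ffunE (unsplitK (inr _)).
Qed.

Lemma tens_mx_scalar b a (v : {ffun 'I_b -> N}) : tens_mx a%:M v = a *: v.
Proof. by rewrite -scalemx1 tens_mxZl tens_mx1. Qed.

(* The rows of c are combinations of Koszul syzygies; all that is kept of this
   is that their coordinate along the newest generator x_s lies in
   (x_0, ..., x_(s-1)). *)
Lemma koszul_relations r :
  (forall i, (i < r)%N -> forall y : N, gen_mul x i (x i *: y) -> gen_mul x i y) ->
  forall v : {ffun 'I_r -> N}, tens_mx (gen_col x r) v = 0 ->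
  exists k (c : 'M[R]_(k, r)) (n : {ffun 'I_k -> N}),
    [/\ c *m gen_col x r = 0, v = tens_mx c n &
      match r return 'M[R]_(k, r) -> Prop with
      | 0 => fun=> True
      | s.+1 => fun c => forall i, gen_ideal x s (c i ord0)
      end c].
Proof.
elim: r => [|r IHr] N_reg v rel_v.
  exists 0%N, 0, [ffun=> 0]; split=> //; first by rewrite mul0mx.
  by apply/ffunP; case.
move: v rel_v; rewrite -[r.+1]/(1 + r)%N /= => v rel_v.
pose v0 := v (lshift r 0); pose v1 := [ffun i => v (rshift 1 i)].
have v0E : [ffun i => v (lshift r i)] = [ffun=> v0].
  by apply/ffunP => i; rewrite !ffunE ord1.
move: rel_v; rewrite tens_mx_col_mx -/v1 v0E tens_mx_scalar => rel_v.
(* The relation puts x_r v0 in (x_0, ..., x_(r-1))N, so regularity gives v0 = sum x_i z_i; then v1 +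
   x_r z is a relation between the earlier generators. *)
have [|z zE] := N_reg r (leqnn _) v0.
  exists (- v1); apply/esym/eqP; rewrite tens_mxNr -addr_eq0 -rel_v.
  by apply/eqP/ffunP => i; rewrite !ffunE.
have [||k [c [n [c0 v'E _]]]] := IHr _ (v1 + x r *: z).
- by move=> i ir; apply: N_reg; apply: ltnW.
- by rewrite tens_mxDr tens_mxZr zE addrC.
(* Upper rows: the syzygies found for the earlier generators, with coordinate 0 along x_r. Lower
   rows: the Koszul syzygies x_i e_r - x_r e_i, weighted by z. *)
exists (k + r)%N, (block_mx 0 c (gen_col x r) (- (x r)%:M)), (ffun_cat n z); split.
- rewrite mul_block_col mul0mx add0r c0 mul_mx_scalar mulNmx mul_scalar_mx.
  by rewrite subrr col_mx0.
- apply/ffunP => j; rewrite /block_mx tens_mx_cat -(splitK j).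
  case: (split j) => {}j; rewrite !ffunE /=.
    rewrite big1 ?add0r => [|i _]; last by rewrite row_mxEl mxE scale0r.
    rewrite (ord1 j) -/v0; have /ffunP/(_ 0) := zE; rewrite !ffunE => <-.
    by apply: eq_bigr => i _; rewrite row_mxEl.
  have /ffunP/(_ j) := v'E; rewrite !ffunE => /(canRL (addrK _)) ->; congr (_ + _).
    by apply: eq_bigr => i _; rewrite row_mxEr.
  rewrite (bigD1 j) //= big1 ?addr0 => [|i /negPf ij].
    by rewrite row_mxEr !mxE eqxx mulr1n scaleNr.
  by rewrite row_mxEr !mxE ij mulr0n oppr0 scale0r.
- move=> i /=; have -> : ord0 = lshift r (ord0 : 'I_1) :> 'I_(1 + r) by apply: val_inj.
  rewrite -(splitK i); case: (split i) => {}i /=.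
    by rewrite block_mxEul mxE; exact: (ideal0 (gen_ideal_ideal r)).
  by rewrite block_mxEdl; apply: gen_ideal_col.
Qed.

End Rigid.

(** * From Tor-rigidity to regularity on R *)

Section RigidRegular.
Variables (R : comNzRingType) (m : idealr R).
Hypotheses (R_noeth : noetherian R) (R_local : local_ring m).

Lemma irredundant_generators (N : lmodType R) :
  nonzero_module N -> finitely_generated N ->
  exists q (g : 'I_q.+1 -> N),
    (forall y, exists c : 'I_q.+1 -> R, y = \sum_i c i *: g i) /\
    (forall c : 'I_q.+1 -> R, \sum_i c i *: g i = 0 -> c ord0 \in m).
Proof.
move=> [y0 y0_neq0] [q [g gP]]; elim: q g gP => [|q IHq] g gP.
  by have [c y0E] := gP y0; case: y0_neq0; rewrite y0E big_ord0.
have [?|/existsNP[c /not_implyP[cg0 /negP c0m]]] :=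
  EM (forall c : 'I_q.+1 -> R, \sum_i c i *: g i = 0 -> c ord0 \in m).
  by exists q, g.
have [u uc] := local_unit R_noeth R_local c0m.
apply: (IHq (fun i => g (lift ord0 i))) => y.
have [d ->] := gP y.
exists (fun i => d (lift ord0 i) - d ord0 * u * c (lift ord0 i)).
rewrite big_ord_recl; move: cg0; rewrite big_ord_recl => /eqP.
rewrite addr_eq0 => /eqP cg0.
have -> : d ord0 *: g ord0 = - ((d ord0 * u) *: \sum_(i < q) c (lift ord0 i) *: g (lift ord0 i)).
  by rewrite -scalerN -cg0 scalerA -mulrA uc mulr1.
rewrite addrC scaler_sumr -sumrB; apply: eq_bigr => i _.
by rewrite scalerBl scalerA.
Qed.

Variables (N : lmodType R) (x : nat -> R) (r : nat).
Hypotheses (N_nonzero : nonzero_module N) (N_fg : finitely_generated N).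
Hypothesis N_rigid : Tor_rigid N.
Hypothesis x_max : forall i, (i <= r)%N -> x i \in m.
Hypothesis N_reg : forall i, (i <= r)%N ->
  forall y : N, gen_mul x i (x i *: y) -> gen_mul x i y.

(* Koszul relations give Tor_1(N, R/(x_0, ..., x_r)) = 0, hence Tor_2 = 0 by
   rigidity.  Given a syzygy b of x and n in N, the N-relation n (x) b is also a
   combination of Koszul relations, and Tor_2 = 0 lifts this to an equality in
   N (x) Syz(x).  So N (x) Syz(x)/Kos(x) = 0; comparing coefficients of one
   irredundant generator of N brings Nakayama down to the ideal of coordinates
   of syzygies along x_r, which is therefore contained in (x_0, ..., x_(r-1)). *)
Lemma rigid_nzd : nzd (gen_ideal x r) (x r).
Proof.
have gen_sub : gen_ideal x r.+1 `<=` [set y | y \in m].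
  by apply: gen_ideal_min; [exact: idealr_ideal | move=> i; rewrite ltnS; apply: x_max].
have gen_proper : ~ gen_ideal x r.+1 1 by move=> /gen_sub /=; rewrite idealr1.
pose I := pack_idealr (gen_ideal_ideal x r.+1) gen_proper.
pose f : {linear 'rV[R]_1 -> quot_module I} := @quot_aug R I.
have f_exact u : f u = 0 <-> exists w, u = w *m gen_col x r.+1.
  apply: (iff_trans (quot_aug_eq0 I u)); apply: (iff_trans (pack_idealrE _ _ _)).
  split=> [[w wE]|[w ->]]; exists w => //.
  by apply/matrixP => i j; rewrite !ord1.
pose F := resolution R_noeth (@quot_aug_surj R I) f_exact.
pose d1 : 'M[R]_(rk F 2, r.+1) := diff F 1.
have d1_exact k (c : 'M[R]_(k, r.+1)) : c *m gen_col x r.+1 = 0 -> exists h, c = h *m d1.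
  exact: (@factor_diff _ _ F 0).
have d1_syz : d1 *m gen_col x r.+1 = 0 by exact: (diff_diff F 0).
have Tor1 : Tor_homology_zero N F 1.
  move=> v /(@koszul_relations R x N r.+1 N_reg)[k [c [n [/d1_exact[h ->] -> _]]]].
  by exists (tens_mx h n); rewrite tens_mxM.
have [F' Tor2'] : Tor_zero 2 N (quot_module I).
  by apply: N_rigid => //; [exact: quot_module_fg | exists F].
have Tor2 : Tor_homology_zero N F 2 := Tor_homology_zero_independent Tor2'.
have [q [g [g_gen g_irr]]] := irredundant_generators N_nonzero N_fg.
have J_id := gen_ideal_ideal x r.
(* The rows of [d1] generate the syzygies of x, and [ord0] is the coordinate along x_r. *)
have d1_gen i : gen_ideal x r (d1 i ord0).
  move: i; apply: (@nakayama R m R_noeth R_local R^o (gen_ideal x r) _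
    (fun i => d1 i ord0)) => // i.
  pose e : 'rV[R]_(rk F 2) := delta_mx 0 i.
  have rel : tens_mx (gen_col x r.+1) (tens_mx d1 (tens (g ord0) e)) = 0.
    by rewrite -tens_mxM d1_syz tens_mx0l.
  have [k [c [n [/d1_exact[h hE] nE c_gen]]]] := @koszul_relations R x N r.+1 N_reg _ rel.
  have [w wE] : exists w, tens (g ord0) e - tens_mx h n = tens_mx (diff F 2) w.
    by apply: Tor2; rewrite tens_mxDr tens_mxNr -tens_mxM -/d1 -hE nE subrr.
  (* The first column of [C *m d1] lies in (x_0, ..., x_(r-1)): by [c_gen] in the rows of [h], and
     because differentials compose to 0 in the others. *)
  pose C := col_mx h (diff F 2); pose n' := ffun_cat n w.
  have CE : tens (g ord0) e = tens_mx C n' by rewrite tens_mx_cat -wE addrC subrK.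
  have C_gen l : gen_ideal x r ((C *m d1) l ord0).
    rewrite mul_col_mx -hE (diff_diff F 1) -(splitK l); case: (split l) => {}l /=.
      by rewrite col_mxEu.
    by rewrite col_mxEd mxE; apply: ideal0.
  have /choice[B BE] : forall l, exists c : 'I_q.+1 -> R, n' l = \sum_i c i *: g i.
    by move=> l; apply: g_gen.
  (* Comparing coefficients of [g ord0] in g_0 (x) e = C n' gives e = rho C modulo m. So entry i is
     a combination of all the entries with coefficients in m, plus an entry of
     [rho *m (C *m d1)]. *)
  pose rho := \row_l B l ord0.
  exists (fun j => e 0 j - (rho *m C) 0 j).
    move=> j; pose a p := (p == ord0)%:R * e 0 j - \sum_l C l j * B l p.
    suff : a ord0 \in m.
      rewrite /a eqxx mul1r [(rho *m C) 0 j]mxE; congr (_ - _ \in m).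
      by apply: eq_bigr => l _; rewrite [rho _ _]mxE mulrC.
    apply: (g_irr a); rewrite /a.
    under eq_bigr do rewrite scalerBl.
    rewrite sumrB; apply/eqP; rewrite subr_eq0; apply/eqP.
    have /ffunP/(_ j) := CE; rewrite !ffunE => CEj.
    rewrite (bigD1 ord0) //= big1 ?addr0 => [|p /negPf->]; last by rewrite mul0r scale0r.
    rewrite ?eqxx ?mulr1n mul1r CEj.
    under [RHS]eq_bigr do rewrite scaler_suml.
    rewrite exchange_big; apply: eq_bigr => l _ /=.
    by rewrite BE scaler_sumr; apply: eq_bigr => p _; rewrite scalerA.
  have -> : d1 i ord0 - \sum_j (e 0 j - (rho *m C) 0 j) *: (d1 j ord0 : R^o)
      = (rho *m (C *m d1)) 0 ord0.
    rewrite mulmxA [RHS]mxE; under eq_bigr do rewrite scalerBl.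
    rewrite sumrB opprB addrCA (_ : \sum_j e 0 j *: (d1 j ord0 : R^o) = d1 i ord0) ?subrr ?addr0 //.
    rewrite (bigD1 i) //= big1 => [|j /negPf ji]; rewrite mxE eqxx ?ji ?eqxx ?scale0r //.
    by rewrite scale1r addr0.
  by rewrite mxE; apply: ideal_sum => // l _; apply: idealM.
(* If x_r a is the combination b of the earlier generators, then (a, -b) is a syzygy with coordinate
   a along x_r. *)
move=> a [b bE].
have [h hE] : exists h : 'rV_(rk F 2), @row_mx _ 1 1 r a%:M (- b) = h *m d1.
  apply: d1_exact; rewrite (@mul_row_col _ 1 1 r) mulNmx -scalar_mxM mulrC -bE.
  by rewrite -mx11_scalar subrr.
have -> : a = (h *m d1) 0 ord0.
  have := @row_mxEl _ 1 1 r a%:M (- b) 0 ord0; rewrite [RHS]mxE mulr1n hE => {1}<-.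
  by congr (fun_of_matrix _ _ _); apply: val_inj.
by rewrite mxE; apply: ideal_sum => // i _; apply: idealM.
Qed.

End RigidRegular.

(** * Suprema and infima of sets of natural numbers *)

Section Bounds.
Implicit Types A B : set nat.

Lemma esup_unbounded A : (forall d, exists2 n, A n & (d < n)%N) -> esup A = +oo%E.
Proof.
move=> A_unb.
have sup_oo : supremums [set n%:Z%:E%E | n in A] +oo%E.
  split=> [x _|[y|//|] y_ub]; first exact: leey.
    have [n An yn] := A_unb `|y|%N.
    have := y_ub _ (imageP (fun n : nat => n%:Z%:E%E) An).
    rewrite lee_fin leNgt; case/negP.
    by rewrite (le_lt_trans (ler_norm y)) // -abszE ltz_nat.
  have [n An _] := A_unb 0%N.
  by have := y_ub _ (imageP (fun n : nat => n%:Z%:E%E) An).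
rewrite /esup /supremum; case: ifPn => [/eqP A0|_].
  have [n An _] := A_unb 0%N.
  have : [set n%:Z%:E%E | n in A] n%:Z%:E%E by exact: imageP.
  by rewrite A0.
case: xgetP => [y _ y_sup|/(_ +oo%E) //].
exact: (is_subset1_supremums y_sup sup_oo).
Qed.

Lemma esup_max A d : A d -> (forall n, A n -> (n <= d)%N) -> esup A = d%:Z%:E%E.
Proof.
move=> Ad A_le.
have sup_d : supremums [set n%:Z%:E%E | n in A] d%:Z%:E%E.
  split=> [_ [n An <-]|y]; last by apply; exact: imageP.
  by rewrite lee_fin lez_nat; apply: A_le.
rewrite /esup /supremum; case: ifPn => [/eqP A0|_].
  have : [set n%:Z%:E%E | n in A] d%:Z%:E%E by exact: imageP.
  by rewrite A0.
case: xgetP => [y _ y_sup|/(_ d%:Z%:E%E) //].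
exact: (is_subset1_supremums y_sup sup_d).
Qed.

Lemma esup_cases A : A !=set0 ->
  esup A = +oo%E \/
  exists d, [/\ A d, forall n, A n -> (n <= d)%N & esup A = d%:Z%:E%E].
Proof.
move=> [n0 An0]; have [A_unb|/existsNP[d Ad]] := EM (forall d, exists2 n, A n & (d < n)%N).
  by left; apply: esup_unbounded.
have A_le n : (`[< A n >] : bool) -> (n <= d)%N.
  by move=> /asboolP An; rewrite leqNgt; apply/negP => dn; apply: Ad; exists n.
have exA : exists n, `[< A n >] by exists n0; apply/asboolP.
case: (ex_maxnP exA A_le) => k /asboolP Ak k_max.
have {}k_max n : A n -> (n <= k)%N by move=> An; apply/k_max/asboolP.
by right; exists k; split=> //; apply: esup_max.
Qed.

Lemma le_esup A n : A n -> (n%:Z%:E <= esup A)%E.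
Proof.
move=> An; have [|->|[d [_ d_max ->]]] := @esup_cases A; first by exists n.
  exact: leey.
by rewrite lee_fin lez_nat; apply: d_max.
Qed.

Lemma esup_le A (y : \bar int) : (forall n, A n -> (n%:Z%:E <= y)%E) -> (esup A <= y)%E.
Proof.
move=> A_le; rewrite /esup /supremum; case: ifPn => [_|_]; first exact: leNye.
case: xgetP => [z _ [_ z_least]|no_sup]; first by apply: z_least => _ [n /A_le ? <-].
exact: leNye.
Qed.

Lemma einf_cases A :
  A = set0 /\ einf A = +oo%E \/ exists2 g, A g & einf A = g%:Z%:E%E.
Proof.
have [->|/set0P[n0 An0]] := eqVneq A set0.
  by left; rewrite /einf image_set0 /infimum eqxx.
right; have exA : exists n, `[< A n >] by exists n0; apply/asboolP.
case: (ex_minnP exA) => g /asboolP Ag g_min; exists g => //.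
have inf_g : infimums [set n%:Z%:E%E | n in A] g%:Z%:E%E.
  split=> [_ [n An <-]|y]; last by apply; exact: imageP.
  by rewrite lee_fin lez_nat; apply/g_min/asboolP.
rewrite /einf /infimum; case: ifPn => [/eqP A0|_].
  have : [set n%:Z%:E%E | n in A] g%:Z%:E%E by exact: imageP.
  by rewrite A0.
case: xgetP => [y _ y_inf|/(_ g%:Z%:E%E) //].
exact: (is_subset1_infimums y_inf inf_g).
Qed.

End Bounds.

(** * Regular sequences in list form, and the bounds on depth *)

Section RegularSequences.
Variable R : comNzRingType.

Lemma gen_mulP (N : lmodType R) (x : nat -> R) r y :
  gen_mul x r y <-> exists z : nat -> N, y = \sum_(j < r) x j *: z j.
Proof.
elim: r y => [|r IHr] y.
  split=> [[z /ffunP/(_ 0)]|[z ->]]; rewrite ?big_ord0.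
    by rewrite !ffunE big_ord0 => <-; exists (fun=> 0); rewrite big_ord0.
  by exists 0; apply/ffunP => j; rewrite !ffunE big_ord0.
split=> [[z zE]|[z ->]].
  have [|w wE] := (IHr (y - x r *: z (lshift r (0 : 'I_1)))).1.
    exists [ffun i => z (@rshift 1 r i)]; apply/ffunP => j.
    have /ffunP/(_ j) := zE; rewrite (@tens_mx_col_mx _ _ 1 r) !ffunE => <-.
    rewrite big_ord1 ffunE !mxE ord1 mulr1n addrC addKr.
    by apply: eq_bigr => i _; rewrite ffunE.
  exists (fun j => if j == r then z (lshift r (0 : 'I_1)) else w j).
  rewrite big_ord_recr /= eqxx -[y](subrK (x r *: z (lshift r (0 : 'I_1)))) wE.
  by congr (_ + _); apply: eq_bigr => i _; rewrite ltn_eqF.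
rewrite big_ord_recr /=.
have [w wE] : gen_mul x r (\sum_(i < r) x i *: z i) by apply/IHr; exists z.
exists (@ffun_cat _ N 1 r [ffun=> z r] w); rewrite (@tens_mx_cat _ _ 1 r) wE tens_mx_scalar.
by apply/ffunP => j; rewrite !ffunE addrC.
Qed.

Lemma gen_idealP (x : nat -> R) r y :
  gen_ideal x r y <-> exists z : nat -> R, y = \sum_(j < r) x j * z j.
Proof.
elim: r y => [|r IHr] y.
  split=> [[c <-]|[z ->]]; first by exists (fun=> 0); rewrite thinmx0 mul0mx mxE big_ord0.
  by rewrite big_ord0; exact: (ideal0 (gen_ideal_ideal x 0)).
rewrite gen_ideal_adj; split=> [[j [b [/IHr[z ->] ->]]]|[z ->]].
  exists (fun j => if j == r then b else z j).
  rewrite big_ord_recr /= eqxx mulrC; congr (_ + _).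
  by apply: eq_bigr => i _; rewrite ltn_eqF.
exists (\sum_(j < r) x j * z j), (z r).
by rewrite big_ord_recr /= mulrC; split=> //; apply/IHr; exists z.
Qed.

Lemma in_ideal_mulP (N : lmodType R) (t : seq R) (y : N) :
  in_ideal_mul t y <-> exists z : nat -> N, y = \sum_(j < size t) t`_j *: z j.
Proof.
split=> [[z ->]|[z ->]]; last by exists (fun j => z j).
exists (fun j => oapp z 0 (insub j)); apply: eq_bigr => j _.
by rewrite valK.
Qed.

Lemma in_ideal_mul_take (N : lmodType R) (s : seq R) i (y : N) : (i <= size s)%N ->
  in_ideal_mul (take i s) y <-> gen_mul (nth 0 s) i y.
Proof.
move=> le_is; apply: (iff_trans (in_ideal_mulP _ _)).
apply: (iff_trans _ (iff_sym (gen_mulP _ _ _))); rewrite size_takel //.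
by split=> -[z ->]; exists z; apply: eq_bigr => j _; rewrite nth_take.
Qed.

Lemma in_ideal_mul_ring (s : seq R) i (y : R) : (i <= size s)%N ->
  in_ideal_mul (take i s) (y : R^o) <-> gen_ideal (nth 0 s) i y.
Proof.
move=> le_is; apply: (iff_trans (in_ideal_mul_take _ le_is)).
by apply: (iff_trans (gen_mulP _ _ _)); apply: iff_sym; apply: gen_idealP.
Qed.

Lemma regular_seq_nzd (s : seq R) : regular_seq (R^o : lmodType R) s ->
  forall i, (i < size s)%N -> nzd (gen_ideal (nth 0 s) i) s`_i.
Proof.
move=> [s_reg _] i lti a /(in_ideal_mul_ring _ (ltnW lti)) /(s_reg i lti).
by move=> /(in_ideal_mul_ring _ (ltnW lti)).
Qed.

Lemma nzd_regular_mod (s : seq R) :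
  (forall i, (i < size s)%N -> nzd (gen_ideal (nth 0 s) i) s`_i) ->
  regular_mod [set 0] s.
Proof.
move=> s_nzd.
have gen0 : gen_ideal (nth 0 s) 0 = [set 0].
  apply/seteqP; split=> [_ [c <-]|_ ->] /=; first by rewrite thinmx0 mul0mx mxE.
  exact: (ideal0 (gen_ideal_ideal _ _)).
rewrite -gen0 -{2}(mkseq_nth 0 s) /mkseq.
have : forall i, (i < size s)%N -> (0 <= i)%N -> nzd (gen_ideal (nth 0 s) i) s`_i.
  by move=> i /s_nzd.
(* The start index 0 is turned into a variable so that the induction can follow [regular_mod] along
   the tails of [s]. *)
rewrite -{1}[size s]add0n.
elim: (size s) 0%N => [|k IHk] j //= j_nzd; split.
  by apply: j_nzd; rewrite // addnS ltnS leq_addr.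
rewrite -gen_ideal_adj; apply: IHk => i; rewrite addSnnS => lti ji.
by apply: j_nzd => //; apply: ltnW.
Qed.

Variables (m : idealr R).

Lemma nzd_regular_seq (s : seq R) : {subset s <= m} ->
  (forall i, (i < size s)%N -> nzd (gen_ideal (nth 0 s) i) s`_i) ->
  regular_seq (R^o : lmodType R) s.
Proof.
move=> sm s_nzd; split=> [i lti y|].
  by move=> /(in_ideal_mul_ring _ (ltnW lti)) /(s_nzd i lti) /(in_ideal_mul_ring _ (ltnW lti)).
exists (1 : R); rewrite -{1}(take_size s) => /(in_ideal_mul_ring _ (leqnn _)) s1.
have /= : [set y | y \in m] 1.
  apply: (gen_ideal_min (idealr_ideal m) _ s1) => i lti.
  by apply: sm; apply: mem_nth.
by rewrite idealr1.
Qed.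

Lemma depth_ge_nzd (s : seq R) : {subset s <= m} ->
  (forall i, (i < size s)%N -> nzd (gen_ideal (nth 0 s) i) s`_i) ->
  depth_ge m [set 0] (size s).
Proof. by move=> sm /nzd_regular_mod s_reg; exists s. Qed.

Hypotheses (R_noeth : noetherian R) (R_local : local_ring m).

Lemma rigid_regular_seq (N : lmodType R) (s : seq R) :
  nonzero_module N -> finitely_generated N -> Tor_rigid N ->
  {subset s <= m} -> regular_seq N s ->
  forall i, (i < size s)%N -> nzd (gen_ideal (nth 0 s) i) s`_i.
Proof.
move=> N_nonzero N_fg N_rigid sm [s_reg _] i lti.
apply: (rigid_nzd R_noeth R_local N_nonzero N_fg N_rigid) => j le_ji.
  by apply: sm; rewrite mem_nth // (leq_ltn_trans le_ji).
have ltj : (j < size s)%N by apply: leq_ltn_trans lti.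
move=> y /(in_ideal_mul_take _ (ltnW ltj)) /(s_reg j ltj).
by move=> /(in_ideal_mul_take _ (ltnW ltj)).
Qed.

Lemma depth_le_ring_dim : (depth m (R^o : lmodType R) <= ring_dim R)%E.
Proof.
apply: esup_le => _ [s [<- sm /regular_seq_nzd s_nzd]].
have [|P PA _] := @associated_above R R_noeth [set 0] 1 (@ideal_set0 R).
  by move/eqP; rewrite oner_eq0.
have [C [C_chain _]] :=
  prime_chain_from_associated R_noeth R_local (@ideal_set0 R) (depth_ge_nzd sm s_nzd) PA.
by apply: le_esup; exists C.
Qed.

Lemma depth_ge_le_dim_grade (M : lmodType R) n :
  nonzero_module M -> finitely_generated M -> depth_ge m [set 0] n ->
  (n%:Z%:E <= module_dim M + grade M)%E.
Proof.
move=> [x0 x0_neq0] M_fg Dn.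
pose I : set R := [set a | forall x : M, a *: x = 0].
have I_id : ideal I.
  split=> [x|a u v Iu Iv x]; first by rewrite scale0r.
  by rewrite scalerDl -scalerA Iu Iv scaler0 addr0.
have I1 : ~ I 1 by move=> /(_ x0); rewrite scale1r.
have [P [P_pr _] IP] := associated_above R_noeth I_id I1.
(* Nonemptiness keeps dim(M) away from -oo, so that dim(M) + grade(M) is +oo as soon as one summand
   is. *)
have dim_n0 : [set n | exists2 P : nat -> prime_idealr R, prime_chain n P &
    forall a : R, (forall x : M, a *: x = 0) -> a \in P 0%N] !=set0.
  exists 0%N; exists (fun=> pack_prime P_pr) => // a aM.
  by apply/(pack_primeE P_pr); apply: IP => x; rewrite mulr1.
have gradeP := einf_cases [set i | ~ @Ext_zero R i M R^o].
have [dimE|[d [_ d_max dimE]]] := esup_cases dim_n0.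
  rewrite /module_dim dimE /grade; have [[_ ->]|[g _ ->]] := gradeP.
    by rewrite addye // leey.
  by rewrite addye // leey.
rewrite /module_dim dimE /grade; have [[_ ->]|[g g_Ext ->]] := gradeP.
  by rewrite addey // leey.
rewrite -EFinD lee_fin -PoszD lez_nat leqNgt; apply/negP => lt_n.
apply: g_Ext; have [F] := resolution_exists R_noeth M_fg.
have Im : {in I, forall x, x \in m} by apply: proper_sub_local.
(* Length g + 1 is needed: a sequence of length t annihilates Ext^i only for i < t, and the
   contradiction is at i = g. *)
have [||s [sz sI s_reg]] := @regular_mod_in_ideal R m R_noeth R_local I d g.+1 n [set 0]
    I_id Im _ (@ideal_set0 R) Dn.
- by move=> k C C_chain IC; apply: d_max; exists C.
- by rewrite addSn addnC.
by apply: (Ext_zero_regular F (s := s)) => //; rewrite sz.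
Qed.

End RegularSequences.

Theorem corollary4p7 (R : comNzRingType) (m : idealr R) (N : lmodType R)
    (R_noeth : noetherian R) (R_local : local_ring m)
    (N_nonzero : nonzero_module N) (N_fg : finitely_generated N)
    (N_rigid : Tor_rigid N) :
  [/\ forall M : lmodType R, nonzero_module M -> finitely_generated M ->
        (depth m N <= module_dim M + grade M)%E,
      (depth m N <= depth m (R^o : lmodType R))%E
    & maximal_Cohen_Macaulay m N -> Cohen_Macaulay_ring m].
Proof.
have s_nzd s : {subset s <= m} -> regular_seq N s ->
    forall i, (i < size s)%N -> nzd (gen_ideal (nth 0 s) i) s`_i.
  by move=> sm; apply: (rigid_regular_seq R_noeth R_local).
have depth_le : (depth m N <= depth m (R^o : lmodType R))%E.
  apply: esup_le => _ [s [<- sm s_reg]]; apply: le_esup; exists s; split=> //.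
  exact: (nzd_regular_seq sm (s_nzd s sm s_reg)).
split=> // [M M_nonzero M_fg|[_ _ depthN]].
  apply: esup_le => _ [s [<- sm s_reg]].
  by apply: (depth_ge_le_dim_grade R_noeth R_local) => //; apply: depth_ge_nzd; auto.
by apply/eqP; rewrite eq_le depth_le_ring_dim //= -depthN.
Qed.
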